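(* Let $\mathcal{D}$ be a unitary multifusion category, and for $m_0,m_1,n_0,n_1\in\mathbb{N}$ let $\mathbf{T}^{m_0,m_1;n_0,n_1}$ be the tube space with $m_0$ inner and $m_1$ outer left legs and $n_0$ inner and $n_1$ outer right legs. Then: (1) $\mathbf{T}^{m,m;n,n}$ is an (associative unital) algebra under stacking for all $m,n\in\mathbb{N}$. (2) For all $m,n,s,t\in\mathbb{N}$, stacking makes $\mathbf{T}^{m,s;n,t}$ a bimodule with a right action of $\mathbf{T}^{m,m;n,n}$ and a left action of $\mathbf{T}^{s,s;t,t}$. (3) These form a Morita context in the sense that $$\mathbf{T}^{m,s;n,t}\otimes_{\mathbf{T}^{m,m;n,n}}\mathbf{T}^{s,m;t,n}\cong\mathbf{T}^{s,s;t,t},\qquad \mathbf{T}^{s,m;t,n}\otimes_{\mathbf{T}^{s,s;t,t}}\mathbf{T}^{m,s;n,t}\cong\mathbf{T}^{m,m;n,n}$$ as bimodules. Hence the algebras $\mathbf{T}^{m,m;n,n}$, $m,n\in\mathbb{N}$, are all Morita equivalent.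
   Context: A unitary multifusion category is a finite semisimple $\mathbb{C}$-linear rigid monoidal category with compatible unitary dagger structure; its unit decomposes as $\mathbf{1}=\bigoplus_{i}\mathbf{1}_i$ with $\mathbf{1}_i$ simple. $\mathrm{Irr}(\mathcal{D})$ is a set of representatives of simple objects. Associators are suppressed. $\mathbb{N}\ni0$. $\mathbf{T}^{m_0,m_1;n_0,n_1}$ is spanned by labelled diagrams on an annulus: a vertical line cut by the inner hole, with upper part labelled $u$ (inner end) and $x$ (outer end), lower part labelled $v$ (inner end) and $y$ (outer end); a left arc from the lower to the upper part carrying $m_0$ legs ending on the inner boundary (labels $c_1,\dots,c_{m_0}$ from top to bottom) and $m_1$ legs ending on the outer boundary (labels $a_1,\dots,a_{m_1}$ from top to bottom); and a right arc similarly carrying $n_0$ inner legs $d_1,\dots,d_{n_0}$ and $n_1$ outer legs $b_1,\dots,b_{n_1}$. Vertices are labelled by morphisms of $\mathcal{D}$. With line segments directed upwards and legs directed outwards, this is the vector space $$\bigoplus\mathrm{Hom}(y,k_0\otimes v\otimes l_0)\otimes\mathrm{Hom}(k_0\otimes c_{m_0}\otimes\cdots\otimes c_1,\,a_{m_1}\otimes\cdots\otimes a_1\otimes k_1)\otimes\mathrm{Hom}(d_1\otimes\cdots\otimes d_{n_0}\otimes l_0,\,l_1\otimes b_1\otimes\cdots\otimes b_{n_1})\otimes\mathrm{Hom}(k_1\otimes u\otimes l_1,x),$$ the sum over all labels $x,y,u,v,k_0,k_1,l_0,l_1,a_i,b_i,c_i,d_i\in\mathrm{Irr}(\mathcal{D})$.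 Elements are written $(P,L,R,U)$ in this order. If the internal strands are replaced by arbitrary objects $K_0,K_1,L_0,L_1$ in place of $k_0,k_1,l_0,l_1$, the corresponding quadruple $(P,L,R,U)$ denotes the element of the tube space obtained by inserting on each of these four strands a resolution of the identity $\mathrm{id}_{K}=\sum_{k\in\mathrm{Irr}(\mathcal{D})}\sum_p p\circ p^*$ ($p\in\mathrm{Hom}(k,K)$ a basis, $p^*\in\mathrm{Hom}(K,k)$ the dual basis, $p^*p'=\delta_{p,p'}\mathrm{id}_k$), and distributing $p^*$ and $p$ to the two morphisms adjacent to the strand. Stacking: for $X=(P,L,R,U)\in\mathbf{T}^{m,s;n,t}$ and $X'=(P',L',R',U')\in\mathbf{T}^{q,m;r,n}$, the product $X\cdot X'\in\mathbf{T}^{q,s;r,t}$ (with $X'$ placed inside $X$) is zero unless the inner labels of $X$ equal the outer labels of $X'$, i.e. $u=x'$, $v=y'$, $c_i=a_i'$, $d_j=b_j'$ for all $i,j$; in that case it is the quadruple with strands $K_\epsilon=k_\epsilon\otimes k'_\epsilon$, $L_\epsilon=l'_\epsilon\otimes l_\epsilon$ ($\epsilon=0,1$) and morphisms $(\mathrm{id}_{k_0}\otimes P'\otimes\mathrm{id}_{l_0})P$, $(L\otimes\mathrm{id}_{k_1'})(\mathrm{id}_{k_0}\otimes L')$, $(\mathrm{id}_{l_1'}\otimes R)(R'\otimes\mathrm{id}_{l_0})$, $U(\mathrm{id}_{k_1}\otimes U'\otimes\mathrm{id}_{l_1})$. The algebra products and the left and right actions in the statement are all instances of stacking. Two algebras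 are Morita equivalent if their module categories are equivalent. *)

(* Defs.v *)
From HB Require Import structures.
From mathcomp Require Import all_boot all_order all_algebra.
From mathcomp Require Import all_classical reals complex.

Set Implicit Arguments.
Unset Strict Implicit.
Unset Printing Implicit Defensive.

Import Order.TTheory GRing.Theory Num.Theory.

Local Open Scope ring_scope.
Local Open Scope quotient_scope.

(* [vectType C] makes the hom spaces finite-dimensional. *)
Record lincat (C : fieldType) := LinCat {
  obj :> Type;
  hom : obj -> obj -> vectType C;
  idm : forall X, hom X X;
  comp : forall X Y Z, hom Y Z -> hom X Y -> hom X Z;
  comp_bilinear : forall X Y Z,
    bilinear_for *:%R *:%R (@comp X Y Z);
  compA : forall W X Y Z (f : hom Y Z) (g : hom X Y) (h : hom W X),
    comp f (comp g h) = comp (comp f g) h;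
  comp1m : forall X Y (f : hom X Y), comp (idm Y) f = f;
  compm1 : forall X Y (f : hom X Y), comp f (idm X) = f
}.

Arguments hom {C l} X Y.
Arguments idm {C l} X.
Arguments comp {C l X Y Z} f g.

Notation "g ∘ f" := (comp g f) (at level 40, left associativity).

Section LinearCategory.
Variables (C : fieldType) (D : lincat C).
Implicit Types X Y Z S : D.

Definition is_iso X Y (f : hom X Y) : Prop :=
  exists2 g : hom Y X, g ∘ f = idm X & f ∘ g = idm Y.

Definition isomorphic X Y : Prop := exists f : hom X Y, is_iso f.

Definition is_mono X Y (f : hom X Y) : Prop :=
  forall Z (g h : hom Z X), f ∘ g = f ∘ h -> g = h.

Definition is_epi X Y (f : hom X Y) : Prop :=
  forall Z (g h : hom Y Z), g ∘ f = h ∘ f -> g = h.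

Definition is_kernel X Y Z (f : hom Y Z) (k : hom X Y) : Prop :=
  f ∘ k = 0 /\
  forall W (g : hom W Y), f ∘ g = 0 -> exists! h : hom W X, k ∘ h = g.

Definition is_cokernel X Y Z (f : hom X Y) (c : hom Y Z) : Prop :=
  c ∘ f = 0 /\
  forall W (g : hom Y W), g ∘ f = 0 -> exists! h : hom Z W, h ∘ c = g.

Definition is_direct_sum n (F : 'I_n -> D) S : Prop :=
  exists (inj : forall j, hom (F j) S) (prj : forall j, hom S (F j)),
    [/\ forall j, prj j ∘ inj j = idm (F j),
        forall j k, j != k -> prj j ∘ inj k = 0
      & \sum_j inj j ∘ prj j = idm S].

(* The case n = 0 of the first clause provides a zero object. *)
Definition is_abelian : Prop :=
  [/\ forall n (F : 'I_n -> D), exists S, is_direct_sum F S,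
      forall X Y (f : hom X Y), exists Z (k : hom Z X), is_kernel f k,
      forall X Y (f : hom X Y), exists Z (c : hom Y Z), is_cokernel f c,
      forall X Y (f : hom X Y), is_mono f ->
        exists Z (g : hom Y Z), is_kernel g f
    & forall X Y (f : hom X Y), is_epi f ->
        exists Z (g : hom Z X), is_cokernel g f].

Definition is_simple X : Prop :=
  idm X <> 0 /\
  forall Y (f : hom Y X), is_mono f -> f = 0 \/ is_iso f.

Definition is_semisimple : Prop :=
  is_abelian /\
  forall X, exists n (F : 'I_n -> D),
    (forall j, is_simple (F j)) /\ is_direct_sum F X.

Definition finitely_many_simples : Prop :=
  exists n (F : 'I_n -> D), forall X, is_simple X -> exists j, isomorphic X (F j).

Definition is_Irr (I : finType) (irr : I -> D) : Prop :=
  [/\ forall i, is_simple (irr i),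
      forall i j, isomorphic (irr i) (irr j) -> i = j
    & forall X, is_simple X -> exists i, isomorphic X (irr i)].

End LinearCategory.

Record moncat (C : fieldType) := MonCat {
  mon_cat :> lincat C;
  unit_obj : mon_cat;
  tens : mon_cat -> mon_cat -> mon_cat;
  tensm : forall X X' Y Y' : mon_cat,
    hom X X' -> hom Y Y' -> hom (tens X Y) (tens X' Y');
  assoc : forall X Y Z : mon_cat, hom (tens (tens X Y) Z) (tens X (tens Y Z));
  associ : forall X Y Z : mon_cat, hom (tens X (tens Y Z)) (tens (tens X Y) Z);
  lunit : forall X : mon_cat, hom (tens unit_obj X) X;
  luniti : forall X : mon_cat, hom X (tens unit_obj X);
  runit : forall X : mon_cat, hom (tens X unit_obj) X;
  runiti : forall X : mon_cat, hom X (tens X unit_obj);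
  tensm_bilinear : forall X X' Y Y', bilinear_for *:%R *:%R (@tensm X X' Y Y');
  tensm_id : forall X Y, tensm (idm X) (idm Y) = idm (tens X Y);
  tensm_comp : forall X X' X'' Y Y' Y'' (f' : hom X' X'') (f : hom X X')
      (g' : hom Y' Y'') (g : hom Y Y'),
    tensm (f' ∘ f) (g' ∘ g) = tensm f' g' ∘ tensm f g;
  assocK : forall X Y Z, associ X Y Z ∘ assoc X Y Z = idm _;
  associK : forall X Y Z, assoc X Y Z ∘ associ X Y Z = idm _;
  lunitK : forall X, luniti X ∘ lunit X = idm _;
  lunitiK : forall X, lunit X ∘ luniti X = idm _;
  runitK : forall X, runiti X ∘ runit X = idm _;
  runitiK : forall X, runit X ∘ runiti X = idm _;
  assoc_nat : forall X X' Y Y' Z Z' (f : hom X X') (g : hom Y Y') (h : hom Z Z'),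
    assoc X' Y' Z' ∘ tensm (tensm f g) h = tensm f (tensm g h) ∘ assoc X Y Z;
  lunit_nat : forall X X' (f : hom X X'),
    lunit X' ∘ tensm (idm unit_obj) f = f ∘ lunit X;
  runit_nat : forall X X' (f : hom X X'),
    runit X' ∘ tensm f (idm unit_obj) = f ∘ runit X;
  pentagon : forall W X Y Z,
    assoc W X (tens Y Z) ∘ assoc (tens W X) Y Z =
    tensm (idm W) (assoc X Y Z) ∘ assoc W (tens X Y) Z
      ∘ tensm (assoc W X Y) (idm Z);
  triangle : forall X Y,
    tensm (idm X) (lunit Y) ∘ assoc X unit_obj Y = tensm (runit X) (idm Y)
}.

Arguments unit_obj {C m}.
Arguments tens {C m} X Y.
Arguments tensm {C m X X' Y Y'} f g.
Arguments assoc {C m} X Y Z.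
Arguments associ {C m} X Y Z.
Arguments lunit {C m} X.
Arguments luniti {C m} X.
Arguments runit {C m} X.
Arguments runiti {C m} X.

Notation "X ⊗ Y" := (tens X Y) (at level 36, right associativity).
Notation "f ⊗m g" := (tensm f g) (at level 36, right associativity).

Section Monoidal.
Variables (C : fieldType) (D : moncat C).

Definition is_left_dual (X Y : D) : Prop :=
  exists (ev : hom (Y ⊗ X) unit_obj) (coev : hom unit_obj (X ⊗ Y)),
    runit X ∘ (idm X ⊗m ev) ∘ assoc X Y X ∘ (coev ⊗m idm X) ∘ luniti X = idm X
    /\
    lunit Y ∘ (ev ⊗m idm Y) ∘ associ Y X Y ∘ (idm Y ⊗m coev) ∘ runiti Y = idm Y.

Definition is_rigid : Prop :=
  forall X : D, (exists Y, is_left_dual X Y) /\ (exists Y, is_left_dual Y X).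

(* X1 ⊗ (X2 ⊗ ( ... (Xn ⊗ 1))), which is 1 for the empty sequence *)
Definition tens_seq (s : seq D) : D := foldr tens unit_obj s.

End Monoidal.

Section Unitary.
Variables (C : numClosedFieldType) (D : moncat C).
Variable dag : forall X Y : D, hom X Y -> hom Y X.

Definition is_dagger : Prop :=
  [/\ forall X Y (k : C) (f g : hom X Y),
        dag (k *: f + g) = k^* *: dag f + dag g,
      forall X, dag (idm X) = idm X,
      forall X Y Z (g : hom Y Z) (f : hom X Y), dag (g ∘ f) = dag f ∘ dag g
    & forall X Y (f : hom X Y), dag (dag f) = f].

(* Completeness of the norms is automatic in finite dimension; [0 <= x] in
   a numClosedFieldType entails that x is real. *)
Definition is_Cstar : Prop :=
  exists nrm : forall X Y : D, hom X Y -> C,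
    (forall X Y (f : hom X Y), 0 <= nrm X Y f) /\
    (forall X Y (f : hom X Y), nrm X Y f = 0 -> f = 0) /\
    (forall X Y (f g : hom X Y), nrm X Y (f + g) <= nrm X Y f + nrm X Y g) /\
    (forall X Y (k : C) (f : hom X Y), nrm X Y (k *: f) = `|k| * nrm X Y f) /\
    (forall X Y Z (g : hom Y Z) (f : hom X Y),
       nrm X Z (g ∘ f) <= nrm Y Z g * nrm X Y f) /\
    (forall X Y (f : hom X Y), nrm X X (dag f ∘ f) = nrm X Y f ^+ 2) /\
    (forall X Y (f : hom X Y), exists g : hom X X, dag f ∘ f = dag g ∘ g).

Definition is_monoidal_dagger : Prop :=
  [/\ forall X X' Y Y' (f : hom X X') (g : hom Y Y'),
        dag (f ⊗m g) = dag f ⊗m dag g,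
      forall X Y Z, dag (assoc X Y Z) = associ X Y Z,
      forall X, dag (lunit X) = luniti X
    & forall X, dag (runit X) = runiti X].

End Unitary.

(* The unit object is not assumed to be simple (``multi''); as any other
   object it is a finite direct sum of simple objects. *)
Record unitary_multifusion (C : numClosedFieldType) := UnitaryMultifusion {
  umf_cat :> moncat C;
  umf_dag : forall X Y : umf_cat, hom X Y -> hom Y X;
  umf_semisimple : is_semisimple umf_cat;
  umf_finite : finitely_many_simples umf_cat;
  umf_rigid : is_rigid umf_cat;
  umf_dagger : is_dagger umf_dag;
  umf_Cstar : is_Cstar umf_dag;
  umf_monoidal_dagger : is_monoidal_dagger umf_dag
}.

Notation vb V := (vbasis {: V}).

Section TensorVect.
Variables (C : fieldType) (V W : vectType C).

(* The tensor product of two finite-dimensional spaces, in coordinates: the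
   matrix t stands for \sum_(i, j) t i j *: (e_i ⊗ e'_j), where e and e' are
   the library's bases of V and W. *)
Definition tensv : vectType C := 'M[C]_(\dim {: V}, \dim {: W}).

Definition ptens (v : V) (w : W) : tensv :=
  \matrix_(i, j) (coord (vb V) i v * coord (vb W) j w).

(* Linear extension of a bilinear map f, see [tensv_lift_ptens]. *)
Definition tensv_lift (Z : lmodType C) (f : V -> W -> Z) (t : tensv) : Z :=
  \sum_i \sum_j (t : 'M_(_, _)) i j *: f (vb V)`_i (vb W)`_j.

Lemma ptens_bilinear : bilinear_for *:%R *:%R ptens.
Proof.
by split=> u k x y; apply/matrixP=> i j; rewrite !mxE linearP ?mulrDl ?mulrDr
  ?mulrA // (mulrC _ k).
Qed.

Lemma tensv_lift_linear (Z : lmodType C) (f : V -> W -> Z) :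
  linear (tensv_lift f).
Proof.
move=> k s t; rewrite /tensv_lift scaler_sumr -big_split /=.
apply: eq_bigr => i _; rewrite scaler_sumr -big_split /=.
by apply: eq_bigr => j _; rewrite !mxE scalerDl scalerA.
Qed.

Lemma tensv_lift_ptens (Z : lmodType C) (f : V -> W -> Z) v w :
  bilinear_for *:%R *:%R f -> tensv_lift f (ptens v w) = f v w.
Proof.
move=> [fl fr].
pose flM u := GRing.isLinear.Build C V Z _ (f^~ u) (fl u).
pose frM u := GRing.isLinear.Build C W Z _ (f u) (fr u).
pose fL u : {linear V -> Z} := HB.pack (f^~ u) (flM u).
pose fR u : {linear W -> Z} := HB.pack (f u) (frM u).
have -> : f v w = fL w v by [].
rewrite {2}(coord_vbasis (memvf v)) linear_sum.
apply: eq_bigr => i _; rewrite linearZ /=.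
have -> : f (vb V)`_i w = fR (vb V)`_i w by [].
rewrite {2}(coord_vbasis (memvf w)) linear_sum scaler_sumr.
by apply: eq_bigr => j _; rewrite linearZ /= mxE scalerA.
Qed.

Lemma tensv_sum_ptens (t : tensv) :
  t = \sum_i \sum_j (t : 'M_(_, _)) i j *: ptens (vb V)`_i (vb W)`_j.
Proof.
have cE (U : vectType C) (i j : 'I_(\dim {: U})) :
    coord (vb U) i (vb U)`_j = (i == j)%:R.
  by rewrite coord_free ?(basis_free (vbasisP _)) // eq_sym.
apply/matrixP=> a b; rewrite summxE (bigD1 a) //= [X in _ + X]big1 ?addr0; last first.
  move=> i /negPf ia; rewrite summxE big1 // => j _.
  by rewrite !mxE !cE eq_sym ia mul0r mulr0.
rewrite summxE (bigD1 b) //= big1 ?addr0; last first.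
  by move=> j /negPf jb; rewrite !mxE !cE (eq_sym b) jb !mulr0.
by rewrite !mxE !cE !eqxx !mulr1.
Qed.

End TensorVect.

Section DirectSum.
Variables (C : fieldType) (J : finType) (V : J -> lmodType C).

Definition dsum := {dffun forall j, V j}.

HB.instance Definition _ := Choice.on dsum.

Implicit Types f g h : dsum.

Definition dsum_zero : dsum := [ffun j => 0 : V j].
Definition dsum_opp f : dsum := [ffun j => - f j].
Definition dsum_add f g : dsum := [ffun j => f j + g j].
Definition dsum_scale (k : C) f : dsum := [ffun j => k *: f j].

Fact dsum_addA : associative dsum_add.
Proof. by move=> f g h; apply/ffunP=> j; rewrite !ffunE addrA. Qed.
Fact dsum_addC : commutative dsum_add.
Proof. by move=> f g; apply/ffunP=> j; rewrite !ffunE addrC. Qed.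
Fact dsum_add0 : left_id dsum_zero dsum_add.
Proof. by move=> f; apply/ffunP=> j; rewrite !ffunE add0r. Qed.
Fact dsum_addN : left_inverse dsum_zero dsum_opp dsum_add.
Proof. by move=> f; apply/ffunP=> j; rewrite !ffunE addNr. Qed.

HB.instance Definition _ :=
  GRing.isZmodule.Build dsum dsum_addA dsum_addC dsum_add0 dsum_addN.

Fact dsum_scaleA a b f : dsum_scale a (dsum_scale b f) = dsum_scale (a * b) f.
Proof. by apply/ffunP=> j; rewrite !ffunE scalerA. Qed.
Fact dsum_scale1 : left_id 1 dsum_scale.
Proof. by move=> f; apply/ffunP=> j; rewrite !ffunE scale1r. Qed.
Fact dsum_scaleDr : right_distributive dsum_scale +%R.
Proof. by move=> k f g; apply/ffunP=> j; rewrite !ffunE scalerDr. Qed.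
Fact dsum_scaleDl f : {morph dsum_scale^~ f : a b / a + b}.
Proof. by move=> a b; apply/ffunP=> j; rewrite !ffunE scalerDl. Qed.

HB.instance Definition _ := GRing.Zmodule_isLmodule.Build C dsum
  dsum_scaleA dsum_scale1 dsum_scaleDr dsum_scaleDl.

End DirectSum.

Section Tube.
Variables (C : fieldType) (D : moncat C) (I : finType) (irr : I -> D).

(* Labels on one boundary circle: on the outer circle ((x, y), a, b), on the
   inner one ((u, v), c, d). *)
Definition circle (s t : nat) : Type := (I * I * (s.-tuple I) * (t.-tuple I))%type.
HB.instance Definition _ s t := Finite.on (circle s t).

Section Circle.
Variables (s t : nat) (o : circle s t).
Definition top : D := irr o.1.1.1.
Definition bot : D := irr o.1.1.2.
(* a_s ⊗ ... ⊗ a_1 *)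
Definition llegs : D := tens_seq [seq irr i | i <- rev o.1.2].
(* b_1 ⊗ ... ⊗ b_t *)
Definition rlegs : D := tens_seq [seq irr i | i <- o.2].
End Circle.

(* Morphism spaces of the four vertices of a diagram with outer labels o,
   inner labels i, and internal strands K0, K1, L0, L1. *)
Section Vertices.
Variables (m s n t : nat) (o : circle s t) (i : circle m n) (K0 K1 L0 L1 : D).
Definition homP : vectType C := hom (bot o) (K0 ⊗ (bot i ⊗ L0)).
Definition homL : vectType C := hom (K0 ⊗ llegs i) (llegs o ⊗ K1).
Definition homR : vectType C := hom (rlegs i ⊗ L0) (L1 ⊗ rlegs o).
Definition homU : vectType C := hom (K1 ⊗ (top i ⊗ L1)) (top o).
End Vertices.

Section TubeSpace.
Variables (m s n t : nat).

(* Internal strands are labelled by w = (k0, k1, l0, l1). *)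
Definition tube_summand (o : circle s t) (i : circle m n) (w : I * I * I * I) :
    vectType C :=
  let: (k0, k1, l0, l1) := w in
  tensv (homP o i (irr k0) (irr l0))
    (tensv (homL o i (irr k0) (irr k1))
      (tensv (homR o i (irr l0) (irr l1)) (homU o i (irr k1) (irr l1)))).

Definition tube_at (o : circle s t) (i : circle m n) : lmodType C :=
  dsum (tube_summand o i).

Definition tube : lmodType C :=
  dsum (fun oi : circle s t * circle m n => tube_at oi.1 oi.2).

Definition tube_proj (X : tube) (o : circle s t) (i : circle m n) :
  tube_at o i := X (o, i).

End TubeSpace.

(* The element p^* of the dual basis, for p the j-th basis vector of
   Hom(k, K).  When [irr] is a set of representatives of the simple objects
   of a semisimple category, exactly one f has this property. *)
Definition dual_basis (k : I) (K : D) (j : 'I_(\dim {: hom (irr k) K})) :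
    hom K (irr k) :=
  xget 0 [set f | forall j' : 'I_(\dim {: hom (irr k) K}),
            f ∘ (vb (hom (irr k) K))`_j' = (j == j')%:R *: idm (irr k)]%classic.

Section Quad.
Variables (m s n t : nat) (o : circle s t) (i : circle m n) (K0 K1 L0 L1 : D).

(* The element (P, L, R, U) with arbitrary internal strands: a resolution of
   the identity \sum_k \sum_p p ∘ p^* is inserted on each strand, p^* going to
   the vertex below and p to the vertex above. *)
Definition quad (P : homP o i K0 L0) (L : homL o i K0 K1)
    (R : homR o i L0 L1) (U : homU o i K1 L1) : tube_at o i :=
  [ffun w => let: (k0, k1, l0, l1) as w' := w return tube_summand o i w' in
    \sum_(p0 < \dim {: hom (irr k0) K0}) \sum_(p1 < \dim {: hom (irr k1) K1})
    \sum_(q0 < \dim {: hom (irr l0) L0}) \sum_(q1 < \dim {: hom (irr l1) L1})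
      let e0 := (vb (hom (irr k0) K0))`_p0 in
      let e1 := (vb (hom (irr k1) K1))`_p1 in
      let f0 := (vb (hom (irr l0) L0))`_q0 in
      let f1 := (vb (hom (irr l1) L1))`_q1 in
      ptens ((dual_basis p0 ⊗m (idm (bot i) ⊗m dual_basis q0)) ∘ P)
     (ptens ((idm (llegs o) ⊗m dual_basis p1) ∘ L ∘ (e0 ⊗m idm (llegs i)))
     (ptens ((dual_basis q1 ⊗m idm (rlegs o)) ∘ R ∘ (idm (rlegs i) ⊗m f0))
            (U ∘ (e1 ⊗m (idm (top i) ⊗m f1)))))].

End Quad.

Section Stack.
Variables (q m s r n t : nat).

(* (P, L, R, U) . (P', L', R', U'), with (P', L', R', U') placed inside; up to
   associators, its components are
     (id_K0 ⊗ P' ⊗ id_L0) P,   (L ⊗ id_K1') (id_K0 ⊗ L'),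
     (id_L1' ⊗ R) (R' ⊗ id_L0),   U (id_K1 ⊗ U' ⊗ id_L1). *)
Definition stack_quad (o : circle s t) (j : circle m n) (i : circle q r)
    (K0 K1 L0 L1 K0' K1' L0' L1' : D)
    (P : homP o j K0 L0) (L : homL o j K0 K1)
    (R : homR o j L0 L1) (U : homU o j K1 L1)
    (P' : homP j i K0' L0') (L' : homL j i K0' K1')
    (R' : homR j i L0' L1') (U' : homU j i K1' L1') : tube_at o i :=
  @quad _ _ _ _ o i (K0 ⊗ K0') (K1 ⊗ K1') (L0' ⊗ L0) (L1' ⊗ L1)
    (associ K0 K0' (bot i ⊗ (L0' ⊗ L0))
      ∘ (idm K0 ⊗m ((idm K0' ⊗m assoc (bot i) L0' L0)
                      ∘ assoc K0' (bot i ⊗ L0') L0))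
      ∘ (idm K0 ⊗m (P' ⊗m idm L0)) ∘ P)
    (assoc (llegs o) K1 K1' ∘ (L ⊗m idm K1') ∘ associ K0 (llegs j) K1'
      ∘ (idm K0 ⊗m L') ∘ assoc K0 K0' (llegs i))
    (associ L1' L1 (rlegs o) ∘ (idm L1' ⊗m R) ∘ assoc L1' (rlegs j) L0
      ∘ (R' ⊗m idm L0) ∘ associ (rlegs i) L0' L0)
    (U ∘ (idm K1 ⊗m (U' ⊗m idm L1))
      ∘ (idm K1 ⊗m (associ K1' (top i ⊗ L1') L1
                      ∘ (idm K1' ⊗m associ (top i) L1' L1)))
      ∘ assoc K1 K1' (top i ⊗ (L1' ⊗ L1))).

Definition lift4 (V1 V2 V3 V4 : vectType C) (Z : lmodType C)
    (f : V1 -> V2 -> V3 -> V4 -> Z) :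
    tensv V1 (tensv V2 (tensv V3 V4)) -> Z :=
  tensv_lift (fun v1 => tensv_lift (fun v2 => tensv_lift (f v1 v2))).

Definition stack_at (o : circle s t) (j : circle m n) (i : circle q r)
    (X : tube_at o j) (X' : tube_at j i) : tube_at o i :=
  \sum_(k0 : I) \sum_(k1 : I) \sum_(l0 : I) \sum_(l1 : I)
  \sum_(k0' : I) \sum_(k1' : I) \sum_(l0' : I) \sum_(l1' : I)
    lift4 (fun P L R U =>
      lift4 (fun P' L' R' U' => stack_quad P L R U P' L' R' U')
        (X' (k0', k1', l0', l1')))
      (X (k0, k1, l0, l1)).

(* The sum over j expresses that the product of two diagrams vanishes unless
   the inner labels of the first are the outer labels of the second. *)
Definition stack (X : tube m s n t) (X' : tube q m r n) : tube q s r t :=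
  [ffun oi => \sum_(j : circle m n)
                stack_at (tube_proj X oi.1 j) (tube_proj X' j oi.2)].

End Stack.

Definition tube_mul m n : tube m m n n -> tube m m n n -> tube m m n n :=
  @stack m m m n n n.
Definition tube_lact m s n t : tube s s t t -> tube m s n t -> tube m s n t :=
  @stack m s s n t t.
Definition tube_ract m s n t : tube m s n t -> tube m m n n -> tube m s n t :=
  @stack m m s n n t.

End Tube.

Arguments tube {C D I} irr m s n t.
Arguments stack {C D I} irr {q m s r n t} X X'.
Arguments tube_mul {C D I} irr m n _ _.
Arguments tube_lact {C D I} irr m s n t _ _.
Arguments tube_ract {C D I} irr m s n t _ _.

Section Algebra.
Variables (C : fieldType).

Record is_algebra (A : lmodType C) (mul : A -> A -> A) (one : A) : Prop :=
  IsAlgebra {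
    alg_bilinear : bilinear_for *:%R *:%R mul;
    alg_assoc : associative mul;
    alg_1l : left_id one mul;
    alg_1r : right_id one mul
  }.

Record is_lmodule (A : lmodType C) (mul : A -> A -> A) (one : A)
    (M : lmodType C) (act : A -> M -> M) : Prop := IsLModule {
  lmodule_bilinear : bilinear_for *:%R *:%R act;
  lmodule_assoc : forall a b x, act a (act b x) = act (mul a b) x;
  lmodule_1 : forall x, act one x = x
}.

Record is_rmodule (A : lmodType C) (mul : A -> A -> A) (one : A)
    (M : lmodType C) (act : M -> A -> M) : Prop := IsRModule {
  rmodule_bilinear : bilinear_for *:%R *:%R act;
  rmodule_assoc : forall x a b, act (act x a) b = act x (mul a b);
  rmodule_1 : forall x, act x one = x
}.

Record is_bimodule (B : lmodType C) (mulB : B -> B -> B) (oneB : B)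
    (A : lmodType C) (mulA : A -> A -> A) (oneA : A)
    (M : lmodType C) (lact : B -> M -> M) (ract : M -> A -> M) : Prop :=
  IsBimodule {
    bimodule_l : is_lmodule mulB oneB lact;
    bimodule_r : is_rmodule mulA oneA ract;
    bimodule_assoc : forall b x a, ract (lact b x) a = lact b (ract x a)
  }.

Definition bimodule_iso (B A M N : lmodType C)
    (lactM : B -> M -> M) (ractM : M -> A -> M)
    (lactN : B -> N -> N) (ractN : N -> A -> N) : Prop :=
  exists phi : {linear M -> N},
    [/\ bijective phi,
        forall b x, phi (lactM b x) = lactN b (phi x)
      & forall x a, phi (ractM x a) = ractN (phi x) a].

End Algebra.

Section TensorOver.
Variables (C : fieldType) (A M N : lmodType C).
Variables (ract : M -> A -> M) (lact : A -> N -> N).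

(* A sequence of pairs stands for the formal sum of the x.1 ⊗ x.2; the
   relation is the smallest linear congruence making ⊗ biadditive,
   C-balanced and A-balanced. *)
Definition fscale (k : C) (s : seq (M * N)) := [seq (k *: x.1, x.2) | x <- s].

Inductive tens_rel : seq (M * N) -> seq (M * N) -> Prop :=
| TRrefl s : tens_rel s s
| TRsym s t : tens_rel s t -> tens_rel t s
| TRtrans s t u : tens_rel s t -> tens_rel t u -> tens_rel s u
| TRcat s s' t t' : tens_rel s s' -> tens_rel t t' -> tens_rel (s ++ t) (s' ++ t')
| TRcatC s t : tens_rel (s ++ t) (t ++ s)
| TRscale k s t : tens_rel s t -> tens_rel (fscale k s) (fscale k t)
| TR0 y : tens_rel [:: (0, y)] [::]
| TRaddl x x' y : tens_rel [:: (x + x', y)] [:: (x, y); (x', y)]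
| TRaddr x y y' : tens_rel [:: (x, y + y')] [:: (x, y); (x, y')]
| TRbalC k x y : tens_rel [:: (k *: x, y)] [:: (x, k *: y)]
| TRbalA x a y : tens_rel [:: (ract x a, y)] [:: (x, lact a y)].

Definition tens_relb (s t : seq (M * N)) : bool := `[< tens_rel s t >].

Fact tens_relb_refl : reflexive tens_relb.
Proof. by move=> s; apply/asboolP; exact: TRrefl. Qed.
Fact tens_relb_sym : symmetric tens_relb.
Proof. by move=> s t; apply/asboolP/asboolP; exact: TRsym. Qed.
Fact tens_relb_trans : transitive tens_relb.
Proof.
by move=> t s u /asboolP st /asboolP tu; apply/asboolP; exact: TRtrans tu.
Qed.

Canonical tens_equiv :=
  EquivRel tens_relb tens_relb_refl tens_relb_sym tens_relb_trans.

Definition tens_over := {eq_quot tens_relb}.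

HB.instance Definition _ := Choice.on tens_over.
HB.instance Definition _ := EqQuotient.on tens_over.

Definition tens_pi (s : seq (M * N)) : tens_over := \pi_tens_over s.

Definition tens_pure (x : M) (y : N) : tens_over := tens_pi [:: (x, y)].

Lemma tens_piP s t : tens_pi s = tens_pi t <-> tens_rel s t.
Proof.
split=> [/eqP|st]; first by rewrite eqmodE => /asboolP.
by apply/eqP; rewrite eqmodE; apply/asboolP.
Qed.

Lemma tens_piK (z : tens_over) : tens_pi (repr z) = z.
Proof. exact: reprK. Qed.

Lemma tens_repr s : tens_rel (repr (tens_pi s)) s.
Proof. by apply/tens_piP; rewrite tens_piK. Qed.

Definition tens_add (z w : tens_over) := tens_pi (repr z ++ repr w).
Definition tens_scale (k : C) (z : tens_over) := tens_pi (fscale k (repr z)).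

Lemma tens_addE s t : tens_add (tens_pi s) (tens_pi t) = tens_pi (s ++ t).
Proof. by apply/tens_piP/TRcat; exact: tens_repr. Qed.
Lemma tens_scaleE k s : tens_scale k (tens_pi s) = tens_pi (fscale k s).
Proof. by apply/tens_piP/TRscale; exact: tens_repr. Qed.

Lemma tens_ind (P : tens_over -> Prop) : (forall s, P (tens_pi s)) -> forall z, P z.
Proof. by move=> Ps z; rewrite -(tens_piK z). Qed.

Fact tens_addA : associative tens_add.
Proof.
elim/tens_ind=> s; elim/tens_ind=> t; elim/tens_ind=> u.
by rewrite !tens_addE catA.
Qed.

Fact tens_addC : commutative tens_add.
Proof.
elim/tens_ind=> s; elim/tens_ind=> t; rewrite !tens_addE.
by apply/tens_piP; exact: TRcatC.
Qed.

Fact tens_add0 : left_id (tens_pi [::]) tens_add.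
Proof. by elim/tens_ind=> s; rewrite tens_addE. Qed.

Lemma tens_pi_cons x s : tens_pi (x :: s) = tens_add (tens_pure x.1 x.2) (tens_pi s).
Proof. by case: x => x y; rewrite tens_addE. Qed.

Lemma fscaleD a b s :
  tens_pi (fscale (a + b) s) = tens_add (tens_pi (fscale a s)) (tens_pi (fscale b s)).
Proof.
elim: s => [|[x y] s IH]; first by rewrite tens_add0.
rewrite /= !tens_pi_cons /= IH.
have -> : tens_pure ((a + b) *: x) y =
    tens_add (tens_pure (a *: x) y) (tens_pure (b *: x) y).
  by rewrite tens_addE; apply/tens_piP; rewrite scalerDl; exact: TRaddl.
rewrite -!tens_addA; congr tens_add.
by rewrite !tens_addA; congr tens_add; rewrite tens_addC.
Qed.

Lemma fscale0 s : tens_pi (fscale 0 s) = tens_pi [::].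
Proof.
elim: s => [//|[x y] s IH]; rewrite /= tens_pi_cons /= IH scale0r.
by rewrite tens_addC tens_add0; apply/tens_piP; exact: TR0.
Qed.

Definition tens_opp := tens_scale (-1).

Lemma tens_scale1 : left_id 1 tens_scale.
Proof.
elim/tens_ind=> s; rewrite tens_scaleE; congr tens_pi.
by elim: s => [//|[x y] s /= ->]; rewrite scale1r.
Qed.

Lemma tens_scaleDl z : {morph tens_scale^~ z : a b / a + b >-> tens_add a b}.
Proof. by elim/tens_ind: z => s a b; rewrite !tens_scaleE fscaleD. Qed.

Fact tens_addN : left_inverse (tens_pi [::]) tens_opp tens_add.
Proof.
move=> z; rewrite -{2}(tens_scale1 z) -tens_scaleDl addNr.
by elim/tens_ind: z => s; rewrite tens_scaleE fscale0.
Qed.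

HB.instance Definition _ :=
  GRing.isZmodule.Build tens_over tens_addA tens_addC tens_add0 tens_addN.

Fact tens_scaleA a b z : tens_scale a (tens_scale b z) = tens_scale (a * b) z.
Proof.
elim/tens_ind: z => s; rewrite !tens_scaleE; congr tens_pi.
by elim: s => [//|[x y] s /= ->]; rewrite scalerA.
Qed.

Fact tens_scaleDr : right_distributive tens_scale +%R.
Proof.
move=> k; elim/tens_ind=> s; elim/tens_ind=> t.
rewrite /GRing.add /= tens_addE !tens_scaleE tens_addE; congr tens_pi.
exact: map_cat.
Qed.

HB.instance Definition _ := GRing.Zmodule_isLmodule.Build C tens_over
  tens_scaleA tens_scale1 tens_scaleDr tens_scaleDl.

(* The actions b . (x ⊗ y) = (b . x) ⊗ y and (x ⊗ y) . c = x ⊗ (y . c),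
   computed on representatives. *)
Definition tens_lact (B : Type) (lactM : B -> M -> M) (b : B) (z : tens_over) :
    tens_over :=
  tens_pi [seq (lactM b x.1, x.2) | x <- repr z].

Definition tens_ract (B : Type) (ractN : N -> B -> N) (z : tens_over) (b : B) :
    tens_over :=
  tens_pi [seq (x.1, ractN x.2 b) | x <- repr z].

End TensorOver.

Section ModuleCategory.
Variables (C : fieldType) (A : lmodType C) (mul : A -> A -> A) (one : A).

Record lmodule := LModule {
  lmodule_sort :> lmodType C;
  lmodule_act : A -> lmodule_sort -> lmodule_sort;
  lmoduleP : is_lmodule mul one lmodule_act
}.

Record lmodule_hom (M N : lmodule) := LModuleHom {
  lmodule_fun :> {linear M -> N};
  lmodule_funP : forall a x,
    lmodule_fun (lmodule_act a x) = lmodule_act a (lmodule_fun x)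
}.

Definition lmodule_id (M : lmodule) : lmodule_hom M M :=
  @LModuleHom M M (idfun : {linear M -> M}) (fun _ _ => erefl).

Fact lmodule_comp_subproof (M N P : lmodule)
    (g : lmodule_hom N P) (f : lmodule_hom M N) a x :
  (g \o f : {linear M -> P}) (lmodule_act a x)
  = lmodule_act a ((g \o f : {linear M -> P}) x).
Proof. by rewrite /= !lmodule_funP. Qed.

Definition lmodule_comp (M N P : lmodule)
    (g : lmodule_hom N P) (f : lmodule_hom M N) : lmodule_hom M P :=
  LModuleHom (lmodule_comp_subproof g f).

End ModuleCategory.

Section Morita.
Variables (C : fieldType).
Variables (A : lmodType C) (mulA : A -> A -> A) (oneA : A).
Variables (B : lmodType C) (mulB : B -> B -> B) (oneB : B).

(* C-linear functors between module categories. Module homomorphisms are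
   compared pointwise; the first law (with k = 0) makes the action on
   homomorphisms respect pointwise equality. *)
Record lmodule_functor := LModuleFunctor {
  fobj :> lmodule mulA oneA -> lmodule mulB oneB;
  fmap : forall M N, lmodule_hom M N -> lmodule_hom (fobj M) (fobj N);
  fmap_linear : forall M N (k : C) (f g h : lmodule_hom M N),
    (forall x, h x = k *: f x + g x) ->
    forall x, fmap h x = k *: fmap f x + fmap g x;
  fmap_id : forall M, fmap (lmodule_id M) =1 id;
  fmap_comp : forall M N P (g : lmodule_hom N P) (f : lmodule_hom M N),
    fmap (lmodule_comp g f) =1 fmap g \o fmap f
}.

End Morita.

Section MoritaEquivalence.
Variables (C : fieldType).
Variables (A : lmodType C) (mulA : A -> A -> A) (oneA : A).
Variables (B : lmodType C) (mulB : B -> B -> B) (oneB : B).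

Definition morita_equivalent : Prop :=
  exists (F : lmodule_functor mulA oneA mulB oneB)
         (G : lmodule_functor mulB oneB mulA oneA)
         (eta : forall M, lmodule_hom (G (F M)) M)
         (eps : forall N, lmodule_hom (F (G N)) N),
    [/\ forall M, bijective (eta M),
        forall M M' (f : lmodule_hom M M'),
          eta M' \o fmap G (fmap F f) =1 f \o eta M,
        forall N, bijective (eps N)
      & forall N N' (f : lmodule_hom N N'),
          eps N' \o fmap F (fmap G f) =1 f \o eps N].

End MoritaEquivalence.

(* Main.v *)
Require Import Defs.
From HB Require Import structures.
From mathcomp Require Import all_boot all_order all_algebra.
From mathcomp Require Import all_classical reals complex.
(* Imported again so that its [hom], [comp], ... shadow those of MathComp. *)
Require Import Defs.

(** Write T(o, i) for the diagrams with outer labels o and inner labels i. It is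
    the coend, over the four internal strands, of the spaces of quadruples
    (P, L, R, U): such a quadruple depends dinaturally on its strands because
    inserted resolutions of the identity may be slid through morphisms, and by
    semisimplicity T(o, i) is spanned by the quadruples with simple strands.
    Hence stacking may be computed on quadruples with arbitrary strands, where
    associativity and unitality hold up to the structural isomorphisms of the
    strands, which the coend does not see. The labels thus form a linear
    category with composition given by stacking.

    In this category every object o with legs A, B and bottom label x is a
    retract of a finite direct sum of objects with any prescribed numbers m, n
    of legs: bend A and B by duality onto the bottom strand, which becomes
    A' ⊗ x ⊗ B', decompose it into simples, and split m + n new legs off the unit
    object, which is a direct sum of simples. So the unit of T^{s,s;t,t} is a
    finite sum of products of an element of T^{m,s;n,t} by one of T^{s,m;t,n},
    which makes both pairings of the Morita context bijective. *)

Set Implicit Arguments.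
Unset Strict Implicit.
Unset Printing Implicit Defensive.

Import Order.TTheory GRing.Theory Num.Theory.

Local Open Scope ring_scope.

(** * Semisimple categories and dual bases *)

(** Simple strands are not closed under stacking and [unit_obj] may fail to be simple, so neither
    products nor units can be written down without resolutions in chosen bases. The coend
    description removes the bases: a linear map out of [tube_at] is determined by its values on
    quadruples with arbitrary strands, and prescribed values extend as soon as they are multilinear
    and dinatural. Each law of stacking then amounts to four equations in the category, one per
    vertex, relating two quadruples by morphisms of their strands. The obstacle is that associators
    are explicit in these equations; letting objects act on the category by tensoring from the left
    makes them disappear. Algebraic closedness of the scalars enters through Schur's lemma:
    endomorphisms of a simple object are scalars, so dual bases exist. A pairing of a Morita context
    that reaches the unit is automatically injective: if 1 is the sum of the ⟨p, q⟩, then x ⊗ y is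
    the sum of the x ⊗ y⟨p, q⟩, which by balancing is the sum of the ⟨x, y⟩p ⊗ q and so depends on
    ⟨x, y⟩ only. *)

Section Bilinear.
Variables (C : fieldType) (U V W : lmodType C) (f : U -> V -> W).
Hypothesis fb : bilinear_for *:%R *:%R f.

Lemma bilPl k x y v : f (k *: x + y) v = k *: f x v + f y v.
Proof. exact: fb.1. Qed.
Lemma bilPr k u x y : f u (k *: x + y) = k *: f u x + f u y.
Proof. exact: fb.2. Qed.

Lemma bilDl v : {morph f^~ v : x y / x + y}.
Proof. by move=> x y; have := bilPl 1 x y v; rewrite !scale1r. Qed.
Lemma bilDr u : {morph f u : x y / x + y}.
Proof. by move=> x y; have := bilPr 1 u x y; rewrite !scale1r. Qed.
Lemma bil0l v : f 0 v = 0.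
Proof. by apply: (addIr (f 0 v)); rewrite -bilDl !add0r. Qed.
Lemma bil0r u : f u 0 = 0.
Proof. by apply: (addIr (f u 0)); rewrite -bilDr !add0r. Qed.
Lemma bilZl k u v : f (k *: u) v = k *: f u v.
Proof. by have := bilPl k u 0 v; rewrite !addr0 bil0l addr0. Qed.
Lemma bilZr k u v : f u (k *: v) = k *: f u v.
Proof. by have := bilPr k u v 0; rewrite !addr0 bil0r addr0. Qed.
Lemma bil_suml (J : Type) (r : seq J) (P : pred J) (F : J -> U) v :
  f (\sum_(j <- r | P j) F j) v = \sum_(j <- r | P j) f (F j) v.
Proof. exact: (big_morph (f^~ v) (bilDl v) (bil0l v)). Qed.
Lemma bil_sumr (J : Type) (r : seq J) (P : pred J) u (F : J -> V) :
  f u (\sum_(j <- r | P j) F j) = \sum_(j <- r | P j) f u (F j).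
Proof. exact: (big_morph (f u) (bilDr u) (bil0r u)). Qed.

End Bilinear.

Section LinearCategoryTheory.
Variables (C : fieldType) (D : lincat C).
Implicit Types X Y Z : D.

Lemma comp_bil X Y Z : bilinear_for *:%R *:%R (@comp C D X Y Z).
Proof. exact: comp_bilinear. Qed.

Lemma comp0m X Y Z (f : hom X Y) : (0 : hom Y Z) ∘ f = 0.
Proof. exact: (bil0l (@comp_bil X Y Z)). Qed.
Lemma compm0 X Y Z (f : hom Y Z) : f ∘ (0 : hom X Y) = 0.
Proof. exact: (bil0r (@comp_bil X Y Z)). Qed.
Lemma compZm X Y Z k (f : hom Y Z) (g : hom X Y) : (k *: f) ∘ g = k *: (f ∘ g).
Proof. exact: (bilZl (@comp_bil X Y Z)). Qed.
Lemma compmZ X Y Z k (f : hom Y Z) (g : hom X Y) : f ∘ (k *: g) = k *: (f ∘ g).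
Proof. exact: (bilZr (@comp_bil X Y Z)). Qed.
Lemma compDm X Y Z (f g : hom Y Z) (h : hom X Y) : (f + g) ∘ h = f ∘ h + g ∘ h.
Proof. exact: (bilDl (@comp_bil X Y Z)). Qed.
Lemma compmD X Y Z (f : hom Y Z) (g h : hom X Y) : f ∘ (g + h) = f ∘ g + f ∘ h.
Proof. exact: (bilDr (@comp_bil X Y Z)). Qed.
Lemma comp_suml X Y Z (J : Type) (r : seq J) (P : pred J) (F : J -> hom Y Z) (f : hom X Y) :
  (\sum_(j <- r | P j) F j) ∘ f = \sum_(j <- r | P j) F j ∘ f.
Proof. exact: (bil_suml (@comp_bil X Y Z)). Qed.
Lemma comp_sumr X Y Z (J : Type) (r : seq J) (P : pred J) (f : hom Y Z) (F : J -> hom X Y) :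
  f ∘ (\sum_(j <- r | P j) F j) = \sum_(j <- r | P j) f ∘ F j.
Proof. exact: (bil_sumr (@comp_bil X Y Z)). Qed.

Lemma iso_eq0 X Y Z (f : hom X Y) (g : hom Z X) : is_iso f -> f ∘ g = 0 -> g = 0.
Proof. by case=> h hf _ fg; rewrite -(comp1m g) -hf -compA fg compm0. Qed.

Lemma kernel_mono X Y Z (f : hom Y Z) (k : hom X Y) : is_kernel f k -> is_mono k.
Proof.
case=> fk0 univ W g h kgh; have [|l [_ lu]] := univ W (k ∘ g).
  by rewrite compA fk0 comp0m.
by rewrite -(lu g erefl) -(lu h).
Qed.

(** The kernel of [f] is a subobject of the simple object X, hence zero or all of X, and the latter
    would force [f] to vanish. *)
Lemma simple_kernel0 X Y (f : hom X Y) :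
  is_abelian D -> is_simple X -> f <> 0 -> is_mono f.
Proof.
case=> _ kerex _ _ _ [_ simX] f0; have [Z [k kerk]] := kerex _ _ f.
case: (simX _ k (kernel_mono kerk)) => [k0|[g _ kg]]; last first.
  by case: f0; rewrite -(compm1 f) -kg compA kerk.1 comp0m.
move=> W g h fgh; apply/subr0_eq.
have [|l [lE _]] := kerk.2 W (g - h).
  by rewrite -scaleN1r compmD compmZ fgh scaleN1r subrr.
by rewrite -lE k0 comp0m.
Qed.

Lemma schur_iso X Y (f : hom X Y) :
  is_abelian D -> is_simple X -> is_simple Y -> f <> 0 -> is_iso f.
Proof.
move=> ab sX [_ sY] f0.
by case: (sY _ f (simple_kernel0 ab sX f0)).
Qed.

End LinearCategoryTheory.

(** Composition with [f] on the space End X has an eigenvector [g], with eigenvalue [c]. If [f - c]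
    were nonzero it would be an isomorphism, yet it kills [g]. *)
Lemma schur_end (C : numClosedFieldType) (D : lincat C) (X : D) (f : hom X X) :
  is_abelian D -> is_simple X -> exists c, f = c *: idm X.
Proof.
move=> ab sX; pose lf : {linear hom X X -> hom X X} :=
  HB.pack (fun g : hom X X => f ∘ g)
    (GRing.isLinear.Build C (hom X X) (hom X X) _ (fun g : hom X X => f ∘ g)
       ((@comp_bil C D X X X).2 f)).
(* The identity of a simple object is nonzero, so the dimension is positive and the characteristic
   polynomial has a root. *)
have [n dimE] : exists n, \dim {: hom X X} = n.+1.
  case E: (\dim {: hom X X}) => [|n]; last by exists n.
  case: sX.1; apply/eqP; rewrite -memv0.
  by rewrite -[0%VS](_ : fullv = _) ?memvf //; apply/eqP; rewrite -dimv_eq0 E.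
pose M : 'M[C]_n.+1 := castmx (dimE, dimE)
  (\matrix_(i, j) coord (vb (hom X X)) j (lf (vb (hom X X))`_i)).
have [c rc] : exists c, root (char_poly M) c.
  by apply: closed_rootP; rewrite size_char_poly.
exists c; apply: contrapT => fc.
have fc0 : f - c *: idm X <> 0 by move/subr0_eq.
have := rc; rewrite -eigenvalue_root_char => /eigenvalueP[v vM v0].
pose w := castmx (erefl, esym dimE) v.
pose g := \sum_i w 0 i *: (vb (hom X X))`_i.
have gE : f ∘ g = c *: g.
  rewrite /g comp_sumr.
  apply: (@eq_trans _ _ (\sum_i \sum_j (w 0 i * coord (vb (hom X X)) j
      (lf (vb (hom X X))`_i)) *: (vb (hom X X))`_j)).
    apply: eq_bigr => i _; rewrite compmZ.
    rewrite -[f ∘ _]/(lf _) [X in _ *: X = _](coord_vbasis (memvf _)) scaler_sumr.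
    by apply: eq_bigr => j _; rewrite scalerA.
  rewrite exchange_big scaler_sumr; apply: eq_bigr => j _ /=.
  rewrite -scaler_suml scalerA; congr (_ *: _).
  have := congr1 (fun u : 'rV_n.+1 => u 0 (cast_ord dimE j)) vM; rewrite !mxE.
  rewrite /w castmxE /= esymK cast_ord_id => <-.
  rewrite (reindex (cast_ord dimE)) /=; last first.
    by exists (cast_ord (esym dimE)) => i _; rewrite ?cast_ordK ?cast_ordKV.
  apply: eq_bigr => i _; rewrite castmxE !castmxE /= !mxE !cast_ord_id.
  by rewrite !esymK !cast_ordK.
have g0 : g = 0.
  apply: (iso_eq0 (schur_iso ab sX sX fc0)).
  by rewrite -scaleNr compDm compZm comp1m gE scaleNr subrr.
case/eqP: v0; apply/rowP => i; rewrite mxE.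
have /freeP/(_ (fun j => w 0 j) g0 (cast_ord (esym dimE) i)) := basis_free (vbasisP {: hom X X}).
by rewrite /w castmxE /= !cast_ord_id esymK cast_ordKV.
Qed.

Section Resolution.
Variables (C : numClosedFieldType) (D : moncat C) (I : finType) (irr : I -> D).
Hypothesis ssD : is_semisimple D.
Hypothesis irrP : is_Irr irr.

Let simple_irr k : is_simple (irr k). Proof. by case: irrP. Qed.

Lemma hom_irr_neq k k' (f : hom (irr k) (irr k')) : k != k' -> f = 0.
Proof.
case: irrP => _ inj _ /eqP kk'; apply: contrapT => f0; apply: kk'; apply: inj.
by exists f; exact: (schur_iso ssD.1).
Qed.

Lemma hom_irr_eq k (f : hom (irr k) (irr k)) : exists c, f = c *: idm (irr k).
Proof. exact: schur_end ssD.1 _. Qed.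

(** Only completeness of the decomposition is recorded: it suffices to test morphisms on simple
    objects. *)
Lemma irr_decomposition (X : D) : exists n (k : 'I_n -> I)
    (e : forall j, hom (irr (k j)) X) (e' : forall j, hom X (irr (k j))),
  \sum_j e j ∘ e' j = idm X.
Proof.
have [n [F [sF [inj [prj [_ _ S1]]]]]] := ssD.2 X.
have [_ _ allF] := irrP.
pose k j := projT1 (cid (allF _ (sF j))).
have isoF j : isomorphic (F j) (irr (k j)) := projT2 (cid (allF _ (sF j))).
pose f j := projT1 (cid (isoF j)).
have iso_f j : is_iso (f j) := projT2 (cid (isoF j)).
pose g j := projT1 (cid2 (iso_f j)).
have gf j : g j ∘ f j = idm _ by rewrite /g; case: cid2.
exists n, k, (fun j => inj j ∘ g j), (fun j => f j ∘ prj j).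
rewrite -S1; apply: eq_bigr => j _.
by rewrite compA -[inj j ∘ g j ∘ f j]compA gf compm1.
Qed.

Lemma hom_irr_ext (X Y : D) (f g : hom X Y) :
  (forall k (p : hom (irr k) X), f ∘ p = g ∘ p) -> f = g.
Proof.
move=> fg; have [n [k [e [e' S1]]]] := irr_decomposition X.
rewrite -[f]compm1 -[g]compm1 -S1 !comp_sumr.
by apply: eq_bigr => j _; rewrite !compA fg.
Qed.

(** This provides the dual bases. On a decomposition of X the functional is represented by the sum
    of the [phi (e j) *: e' j] over the summands labelled [k], since each [e' j ∘ p] is a scalar
    there and zero elsewhere. *)
Lemma hom_irr_functional k (X : D) (phi : hom (irr k) X -> C) :
  scalar phi -> exists f : hom X (irr k), forall p, f ∘ p = phi p *: idm (irr k).
Proof.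
move=> phil; have [n [kk [e [e' S1]]]] := irr_decomposition X.
pose phiL : {linear hom (irr k) X -> C^o} :=
  HB.pack phi (GRing.isLinear.Build C (hom (irr k) X) C^o _ phi phil).
(* The scalar [phi (e j)] as a morphism; the equality [E] of labels is needed already for this to be
   well typed. *)
pose h j : hom (irr (kk j)) (irr k) :=
  match eqVneq (kk j) k with
  | EqNotNeq E => phi (eq_rect _ (fun l => hom (irr l) X) (e j) _ E)
                  *: eq_rect _ (fun l => hom (irr (kk j)) (irr l)) (idm _) _ E
  | NeqNotEq _ => 0
  end.
exists (\sum_j h j ∘ e' j) => p.
rewrite comp_suml -[phi p]/(phiL p) -{2}(comp1m p) -S1 comp_suml linear_sum scaler_suml.
apply: eq_bigr => j _; rewrite -!compA.
rewrite /h; case: eqVneq => [E|ne]; last first.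
  by rewrite [e' j ∘ p](hom_irr_neq _ ) 1?eq_sym // !compm0 linear0 scale0r.
move: (e' j ∘ p) (e j); move: (kk j) E => l E; subst l => q ej /=.
have [c ->] := hom_irr_eq q.
rewrite !compmZ !compm1.
have -> : phi (c *: ej) = c * phi ej by exact: (linearZ_LR phiL c ej).
by rewrite scalerA mulrC.
Qed.

Lemma dual_basis_coord k (X : D) p (q : hom (irr k) X) :
  dual_basis p ∘ q = coord (vb (hom (irr k) X)) p q *: idm (irr k).
Proof.
suff H (j : 'I_(\dim {: hom (irr k) X})) :
    dual_basis p ∘ (vb (hom (irr k) X))`_j = (p == j)%:R *: idm (irr k).
  rewrite [X in _ ∘ X](coord_vbasis (memvf q)) comp_sumr (bigD1 p) //=.
  rewrite compmZ H eqxx scale1r big1 ?addr0 // => j jp.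
  by rewrite compmZ H eq_sym (negPf jp) scale0r scaler0.
(* The default value 0 is never taken: the p-th coordinate is a linear functional, hence represented
   by a morphism. *)
rewrite /dual_basis; case: xgetP => [f _ -> //|/= nex].
pose phi (r : hom (irr k) X) : C := coord (vb (hom (irr k) X)) p r.
have [|f fP] := @hom_irr_functional k X phi; first by move=> a u v; rewrite /phi linearP.
case: (nex f) => j'; rewrite fP /phi coord_free ?(basis_free (vbasisP _)) //.
by rewrite eq_sym.
Qed.

Lemma basis_resolution k (X : D) (q : hom (irr k) X) :
  \sum_(p < \dim {: hom (irr k) X}) (vb (hom (irr k) X))`_p ∘ (dual_basis p ∘ q) = q.
Proof.
rewrite [RHS](coord_vbasis (memvf q)); apply: eq_bigr => p _.
by rewrite dual_basis_coord compmZ compm1.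
Qed.

Lemma dual_resolution k (X : D) (q : hom X (irr k)) :
  \sum_(p < \dim {: hom (irr k) X}) q ∘ ((vb (hom (irr k) X))`_p ∘ dual_basis p) = q.
Proof.
apply: hom_irr_ext => k' r; rewrite comp_suml.
have [E|ne] := eqVneq k' k; last first.
  rewrite [q ∘ r](hom_irr_neq _ ne) big1 // => p _.
  by rewrite -!compA [dual_basis p ∘ r](hom_irr_neq _ ne) !compm0.
move: r; rewrite E => r; under eq_bigr do rewrite -!compA.
by rewrite -comp_sumr basis_resolution.
Qed.

Lemma resolution (X : D) :
  \sum_k \sum_(p < \dim {: hom (irr k) X}) (vb (hom (irr k) X))`_p ∘ dual_basis p
  = idm X.
Proof.
apply: hom_irr_ext => k q; rewrite comp1m comp_suml (bigD1 k) //=.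
rewrite [X in _ + X]big1 => [|k' kk'].
  by rewrite addr0 comp_suml -[RHS]basis_resolution; under [RHS]eq_bigr do rewrite compA.
rewrite comp_suml big1 // => p _.
by rewrite -compA [dual_basis p ∘ q](hom_irr_neq _ ) 1?eq_sym // compm0.
Qed.

(** The matrix of [f] in the bases of Hom(k, X) and Hom(k, Y) also expresses [dual_basis p ∘ f] in
    the dual basis; bilinearity moves its coefficients from one slot to the other. Dinaturality of
    [quad] in each strand comes from here. *)
Lemma dual_basis_dinatural k (X Y : D) (Z : lmodType C) (f : hom X Y)
    (psi : hom X (irr k) -> hom (irr k) Y -> Z) :
  bilinear_for *:%R *:%R psi ->
  \sum_(p < \dim {: hom (irr k) Y}) psi (dual_basis p ∘ f) (vb (hom (irr k) Y))`_p
  = \sum_(p < \dim {: hom (irr k) X}) psi (dual_basis p) (f ∘ (vb (hom (irr k) X))`_p).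
Proof.
move=> psib; under eq_bigr => p _.
  rewrite -(dual_resolution (dual_basis p ∘ f)) (bil_suml psib).
  under eq_bigr => p' _ do rewrite -compA [f ∘ _]compA [dual_basis p ∘ _]compA
    dual_basis_coord compZm comp1m (bilZl psib) -(bilZr psib).
over.
rewrite exchange_big; apply: eq_bigr => p' _ /=.
by rewrite -(bil_sumr psib) -(coord_vbasis (memvf _)).
Qed.

End Resolution.

(** * Strictification of monoidal categories *)

Section MonoidalTheory.
Variables (C : fieldType) (D : moncat C).
Implicit Types X Y Z : D.

Lemma tensm_bil X X' Y Y' : bilinear_for *:%R *:%R (@tensm C D X X' Y Y').
Proof. exact: tensm_bilinear. Qed.

Lemma lw_comp X Y Y' Y'' (g : hom Y' Y'') (f : hom Y Y') :
  idm X ⊗m (g ∘ f) = (idm X ⊗m g) ∘ (idm X ⊗m f).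
Proof. by rewrite -tensm_comp comp1m. Qed.
Lemma rw_comp X Y Y' Y'' (g : hom Y' Y'') (f : hom Y Y') :
  (g ∘ f) ⊗m idm X = (g ⊗m idm X) ∘ (f ⊗m idm X).
Proof. by rewrite -tensm_comp comp1m. Qed.
Lemma tensm_lr X X' Y Y' (f : hom X X') (g : hom Y Y') :
  f ⊗m g = (f ⊗m idm Y') ∘ (idm X ⊗m g).
Proof. by rewrite -tensm_comp comp1m compm1. Qed.
Lemma tensm_rl X X' Y Y' (f : hom X X') (g : hom Y Y') :
  f ⊗m g = (idm X' ⊗m g) ∘ (f ⊗m idm Y).
Proof. by rewrite -tensm_comp comp1m compm1. Qed.

Lemma lunitm_inj X Y (f g : hom X Y) : idm unit_obj ⊗m f = idm unit_obj ⊗m g -> f = g.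
Proof.
move=> fg; rewrite -[f]compm1 -[g]compm1 -(lunitiK X) !compA.
by rewrite -!lunit_nat fg.
Qed.

Lemma runitm_inj X Y (f g : hom X Y) : f ⊗m idm unit_obj = g ⊗m idm unit_obj -> f = g.
Proof.
move=> fg; rewrite -[f]compm1 -[g]compm1 -(runitiK X) !compA.
by rewrite -!runit_nat fg.
Qed.

(** Kelly's argument: tensoring with the unit object is faithful, and after doing so the pentagon
    for (1, 1, X, Y) and the triangle give the claim. *)
Lemma lunit_tens X Y : lunit (X ⊗ Y) ∘ assoc unit_obj X Y = lunit X ⊗m idm Y.
Proof.
apply: lunitm_inj; rewrite lw_comp.
(* The two associators are invertible and may be cancelled; they complete the source to the one of
   the pentagon. *)
have e (f g : hom (unit_obj ⊗ (unit_obj ⊗ X) ⊗ Y) (unit_obj ⊗ (X ⊗ Y))) :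
    f ∘ assoc unit_obj (unit_obj ⊗ X) Y ∘ (assoc unit_obj unit_obj X ⊗m idm Y)
    = g ∘ assoc unit_obj (unit_obj ⊗ X) Y ∘ (assoc unit_obj unit_obj X ⊗m idm Y) -> f = g.
  move=> fg; rewrite -[f]compm1 -[g]compm1 -(associK unit_obj (unit_obj ⊗ X) Y).
  rewrite !compA; congr (_ ∘ _).
  rewrite -[LHS]compm1 -[RHS]compm1 -tensm_id -(associK unit_obj unit_obj X) rw_comp !compA.
  by rewrite fg.
apply: e; rewrite -!compA [(idm _ ⊗m assoc _ _ _) ∘ _]compA -pentagon compA triangle.
have := assoc_nat (runit unit_obj) (idm X) (idm Y).
rewrite tensm_id => <-; rewrite compA -assoc_nat -compA; congr (_ ∘ _).
by rewrite -rw_comp triangle.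
Qed.

End MonoidalTheory.

(* Mac Lane strictification: an object expression [a] acts on objects by
   [Z |-> act a Z], which is [den a ⊗ Z] with brackets and units removed. A
   morphism [f] becomes the natural transformation [strict f]; structural
   isomorphisms become identities, and nothing is lost ([strict_inj]). *)
Section Strictification.
Variables (C : fieldType) (D : moncat C).
Implicit Types X Y Z : D.

Inductive obexp := Atom of D | Unit | Tens of obexp & obexp.
Implicit Types a b c : obexp.

Fixpoint den a : D :=
  match a with Atom X => X | Unit => unit_obj | Tens a b => den a ⊗ den b end.

Fixpoint act a Z : D :=
  match a with Atom X => X ⊗ Z | Unit => Z | Tens a b => act a (act b Z) end.

Fixpoint actm a Z Z' (g : hom Z Z') : hom (act a Z) (act a Z') :=
  match a with
  | Atom X => idm X ⊗m g
  | Unit => g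
  | Tens a b => actm a (actm b g)
  end.

Fixpoint flat a Z : hom (den a ⊗ Z) (act a Z) :=
  match a with
  | Atom X => idm _
  | Unit => lunit Z
  | Tens a b => flat a (act b Z) ∘ (idm _ ⊗m flat b Z) ∘ assoc _ _ _
  end.

Fixpoint flati a Z : hom (act a Z) (den a ⊗ Z) :=
  match a with
  | Atom X => idm _
  | Unit => luniti Z
  | Tens a b => associ _ _ _ ∘ ((idm _ ⊗m flati b Z) ∘ flati a (act b Z))
  end.

Lemma flatK a Z : flati a Z ∘ flat a Z = idm _.
Proof.
elim: a Z => [X|| a IHa b IHb] Z /=; first by rewrite comp1m.
  exact: lunitK.
rewrite -!compA [flati a _ ∘ _]compA IHa comp1m [(idm _ ⊗m _) ∘ (_ ∘ _)]compA.
by rewrite -lw_comp IHb tensm_id comp1m assocK.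
Qed.

Lemma flatiK a Z : flat a Z ∘ flati a Z = idm _.
Proof.
elim: a Z => [X|| a IHa b IHb] Z /=; first by rewrite comp1m.
  exact: lunitiK.
rewrite -!compA [assoc _ _ _ ∘ _]compA associK comp1m [(idm _ ⊗m _) ∘ (_ ∘ _)]compA.
by rewrite -lw_comp IHb tensm_id comp1m IHa.
Qed.

Lemma flat_nat a Z Z' (g : hom Z Z') :
  flat a Z' ∘ (idm _ ⊗m g) = actm a g ∘ flat a Z.
Proof.
elim: a Z Z' g => [X|| a IHa b IHb] Z Z' g /=; first by rewrite comp1m compm1.
  exact: lunit_nat.
rewrite -tensm_id -!compA assoc_nat !compA -IHa; congr (_ ∘ _).
by rewrite -!compA -!lw_comp IHb.
Qed.

(* [locked] stops [rewrite] from unfolding [strict] to a composite. *)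
Definition strict a b (f : hom (den a) (den b)) Z : hom (act a Z) (act b Z) :=
  locked (flat b Z ∘ ((f ⊗m idm Z) ∘ flati a Z)).

Lemma strict_inj a b (f g : hom (den a) (den b)) :
  strict f unit_obj = strict g unit_obj -> f = g.
Proof.
move=> fg; apply: runitm_inj.
have e h : h ⊗m idm unit_obj = flati b unit_obj ∘ (strict h unit_obj ∘ flat a unit_obj).
  by rewrite /strict -!lock -!compA flatK compm1 compA flatK comp1m.
by rewrite !e fg.
Qed.

(** The interchange law in strict form: [f] acts on the first factors and [g] on the tail. It is the
    only relation left between generators. *)
Lemma strict_nat a b (f : hom (den a) (den b)) Z Z' (g : hom Z Z') :
  strict f Z' ∘ actm a g = actm b g ∘ strict f Z.
Proof.
have e : actm a g = flat a Z' ∘ ((idm _ ⊗m g) ∘ flati a Z).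
  by rewrite compA flat_nat -compA flatiK compm1.
rewrite e /strict -!lock -!compA [flati a Z' ∘ _]compA flatK comp1m.
by rewrite [(f ⊗m _) ∘ _]compA -tensm_lr tensm_rl -!compA compA flat_nat -compA.
Qed.

Lemma strict_comp a b c (g : hom (den b) (den c)) (f : hom (den a) (den b)) Z :
  strict (a := a) (b := c) (g ∘ f) Z = strict g Z ∘ strict f Z.
Proof.
by rewrite /strict -!lock rw_comp -!compA [flati b _ ∘ _]compA flatK comp1m.
Qed.

Lemma strict_id a Z : strict (a := a) (b := a) (idm (den a)) Z = idm _.
Proof. by rewrite /strict -!lock tensm_id comp1m flatiK. Qed.

Lemma strict_tens a a' b b' (f : hom (den a) (den b)) (g : hom (den a') (den b')) Z :
  strict (a := Tens a a') (b := Tens b b') (f ⊗m g) Z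
  = strict f (act b' Z) ∘ actm a (strict g Z).
Proof.
have e : actm a (strict g Z) = flat a _ ∘ ((idm _ ⊗m strict g Z) ∘ flati a _).
  by rewrite compA flat_nat -compA flatiK compm1.
rewrite e /strict -!lock /= -!compA; congr (_ ∘ _).
rewrite [flati a _ ∘ _]compA flatK comp1m [assoc _ _ _ ∘ _]compA assoc_nat -!compA.
rewrite [assoc _ _ _ ∘ _]compA associK comp1m !lw_comp -!compA.
by rewrite !compA -!tensm_comp !comp1m !compm1.
Qed.

(** Both bracketings flatten to the same object, and the two ways of getting there agree by the
    pentagon. *)
Lemma strict_assoc a b c Z :
  strict (a := Tens (Tens a b) c) (b := Tens a (Tens b c)) (assoc (den a) (den b) (den c)) Z
  = idm _.
Proof.
rewrite /strict -!lock -[RHS](flatiK (Tens (Tens a b) c)) compA; congr (_ ∘ _) => /=.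
rewrite !lw_comp -!compA; congr (_ ∘ _).
rewrite [assoc (den a) (den b) (act c Z) ∘ _]compA -[idm (den a ⊗ den b)]tensm_id.
rewrite assoc_nat -!compA; congr (_ ∘ _); congr (_ ∘ _).
by rewrite compA -pentagon.
Qed.

Lemma strict_associ a b c Z :
  strict (a := Tens a (Tens b c)) (b := Tens (Tens a b) c) (associ (den a) (den b) (den c)) Z
  = idm _.
Proof.
have := strict_comp (a := Tens (Tens a b) c) (b := Tens a (Tens b c)) (c := Tens (Tens a b) c)
  (associ _ _ _) (assoc _ _ _) Z.
by rewrite assocK strict_assoc strict_id compm1 => <-.
Qed.

Lemma strict_lunit a Z : strict (a := Tens Unit a) (b := a) (lunit (den a)) Z = idm _.
Proof.
rewrite /strict -!lock -[RHS](flatiK (Tens Unit a)) compA; congr (_ ∘ _) => /=.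
by rewrite lunit_nat -compA lunit_tens.
Qed.

Lemma strict_luniti a Z : strict (a := a) (b := Tens Unit a) (luniti (den a)) Z = idm _.
Proof.
have := strict_comp (a := Tens Unit a) (b := a) (c := Tens Unit a) (luniti _) (lunit _) Z.
by rewrite lunitK strict_lunit strict_id compm1 => <-.
Qed.

Lemma strict_runit a Z : strict (a := Tens a Unit) (b := a) (runit (den a)) Z = idm _.
Proof.
rewrite /strict -!lock -[RHS](flatiK (Tens a Unit)) compA; congr (_ ∘ _) => /=.
by rewrite -compA triangle.
Qed.

Lemma strict_runiti a Z : strict (a := a) (b := Tens a Unit) (runiti (den a)) Z = idm _.
Proof.
have := strict_comp (a := Tens a Unit) (b := a) (c := Tens a Unit) (runiti _) (runit _) Z.
by rewrite runitK strict_runit strict_id compm1 => <-.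
Qed.

End Strictification.

(** * Coherence of stacking *)

Ltac reify_obj X :=
  lazymatch X with
  | tens ?A ?B => let a := reify_obj A in let b := reify_obj B in constr:(Tens a b)
  | @unit_obj ?C ?D => constr:(@Unit C D)
  | _ => constr:(Atom X)
  end.

(** Pushes [strict] down to the generators, so that structural isomorphisms vanish and composites of
    whiskered generators remain, bracketed to the right. The middle object of a composite is reified
    again because [strict] depends on an expression for it, not only on its value. *)
Ltac strict_push :=
  repeat match goal with
  | |- context[@strict _ _ ?a ?a (idm _) ?W] => rewrite (@strict_id _ _ a W)
  | |- context[@strict _ _ ?a ?c (@comp _ _ ?X ?Y ?Z ?g ?f) ?W] =>
      let b := reify_obj Y in rewrite (@strict_comp _ _ a b c g f W)
  | |- context[@strict _ _ (Tens ?a ?a') (Tens ?b ?b') (tensm ?f ?g) ?W] =>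
      rewrite (@strict_tens _ _ a a' b b' f g W)
  | |- context[@strict _ _ (Tens (Tens ?a ?b) ?c) _ (assoc _ _ _) ?W] =>
      rewrite (@strict_assoc _ _ a b c W)
  | |- context[@strict _ _ (Tens ?a (Tens ?b ?c)) _ (associ _ _ _) ?W] =>
      rewrite (@strict_associ _ _ a b c W)
  | |- context[@strict _ _ _ ?a (lunit _) ?W] => rewrite (@strict_lunit _ _ a W)
  | |- context[@strict _ _ ?a _ (luniti _) ?W] => rewrite (@strict_luniti _ _ a W)
  | |- context[@strict _ _ _ ?a (runit _) ?W] => rewrite (@strict_runit _ _ a W)
  | |- context[@strict _ _ ?a _ (runiti _) ?W] => rewrite (@strict_runiti _ _ a W)
  end;
  cbn [act actm];
  rewrite ?tensm_id ?comp1m ?compm1 ?lw_comp ?tensm_id ?comp1m ?compm1 -?compA.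

Ltac strictify :=
  match goal with |- @eq (_ (@hom _ _ ?X ?Y)) ?f ?g =>
    let a := reify_obj X in let b := reify_obj Y in
    apply: (@strict_inj _ _ a b f g)
  end; strict_push.

Section Stacking.
Variables (C : fieldType) (D : moncat C).
Implicit Types X Y Z K L A B : D.

(** The four components of [stack_quad], with arbitrary objects in place of the boundary labels: the
    bent bottom strand of the factorization argument is not simple. *)
Definition stackP K L K' L' x y z (P : hom x (K ⊗ (y ⊗ L))) (P' : hom y (K' ⊗ (z ⊗ L'))) :
    hom x ((K ⊗ K') ⊗ (z ⊗ (L' ⊗ L))) :=
  associ K K' (z ⊗ (L' ⊗ L))
    ∘ (idm K ⊗m ((idm K' ⊗m assoc z L' L) ∘ assoc K' (z ⊗ L') L))
    ∘ (idm K ⊗m (P' ⊗m idm L)) ∘ P.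

Definition stackL K0 K1 K0' K1' A B E (L : hom (K0 ⊗ B) (A ⊗ K1))
    (L' : hom (K0' ⊗ E) (B ⊗ K1')) :
    hom ((K0 ⊗ K0') ⊗ E) (A ⊗ (K1 ⊗ K1')) :=
  assoc A K1 K1' ∘ (L ⊗m idm K1') ∘ associ K0 B K1' ∘ (idm K0 ⊗m L') ∘ assoc K0 K0' E.

Definition stackR L0 L1 L0' L1' A B E (R : hom (B ⊗ L0) (L1 ⊗ A))
    (R' : hom (E ⊗ L0') (L1' ⊗ B)) :
    hom (E ⊗ (L0' ⊗ L0)) ((L1' ⊗ L1) ⊗ A) :=
  associ L1' L1 A ∘ (idm L1' ⊗m R) ∘ assoc L1' B L0 ∘ (R' ⊗m idm L0) ∘ associ E L0' L0.

Definition stackU K L K' L' x y z (U : hom (K ⊗ (y ⊗ L)) x) (U' : hom (K' ⊗ (z ⊗ L')) y) :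
    hom ((K ⊗ K') ⊗ (z ⊗ (L' ⊗ L))) x :=
  U ∘ (idm K ⊗m (U' ⊗m idm L))
    ∘ (idm K ⊗m (associ K' (z ⊗ L') L ∘ (idm K' ⊗m associ z L' L)))
    ∘ assoc K K' (z ⊗ (L' ⊗ L)).

(** The two iterated stackings have differently bracketed strands. The four associativity lemmas are
    the four conditions of [dinatural] for the associators of the strands. *)
Lemma stackP_assoc K L K' L' K'' L'' x y z w (P : hom x (K ⊗ (y ⊗ L)))
    (P' : hom y (K' ⊗ (z ⊗ L'))) (P'' : hom z (K'' ⊗ (w ⊗ L''))) :
  stackP P (stackP P' P'')
  = (assoc K K' K'' ⊗m (idm w ⊗m associ L'' L' L)) ∘ stackP (stackP P P') P''.
Proof. by rewrite /stackP; strictify. Qed.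

Lemma stackU_assoc K L K' L' K'' L'' x y z w (P : hom (K ⊗ (y ⊗ L)) x)
    (P' : hom (K' ⊗ (z ⊗ L')) y) (P'' : hom (K'' ⊗ (w ⊗ L'')) z) :
  stackU (stackU P P') P''
  = stackU P (stackU P' P'') ∘ (assoc K K' K'' ⊗m (idm w ⊗m associ L'' L' L)).
Proof. by rewrite /stackU; strictify. Qed.

Lemma stackL_assoc K0 K1 K0' K1' K0'' K1'' A B E F (L : hom (K0 ⊗ B) (A ⊗ K1))
    (L' : hom (K0' ⊗ E) (B ⊗ K1')) (L'' : hom (K0'' ⊗ F) (E ⊗ K1'')) :
  stackL L (stackL L' L'') ∘ (assoc K0 K0' K0'' ⊗m idm F)
  = (idm A ⊗m assoc K1 K1' K1'') ∘ stackL (stackL L L') L''.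
Proof. by rewrite /stackL; strictify. Qed.

Lemma stackR_assoc K0 K1 K0' K1' K0'' K1'' A B E F (L : hom (B ⊗ K0) (K1 ⊗ A))
    (L' : hom (E ⊗ K0') (K1' ⊗ B)) (L'' : hom (F ⊗ K0'') (K1'' ⊗ E)) :
  stackR L (stackR L' L'') ∘ (idm F ⊗m associ K0'' K0' K0)
  = (associ K1'' K1' K1 ⊗m idm A) ∘ stackR (stackR L L') L''.
Proof. by rewrite /stackR; strictify. Qed.

Lemma comp_square V W X X' Y (f : hom X Y) (g : hom W X) (f' : hom X' Y) (g' : hom W X')
    (h : hom V W) :
  f ∘ g = f' ∘ g' -> f ∘ (g ∘ h) = f' ∘ (g' ∘ h).
Proof. by rewrite !compA => ->. Qed.

Lemma strict_slide X Y W Z Z' (f : hom X Y) (g : hom Z Z') (h : hom W (X ⊗ Z)) :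
  strict (a := Atom X) (b := Atom Y) f Z' ∘ ((idm X ⊗m g) ∘ h)
  = (idm Y ⊗m g) ∘ (strict (a := Atom X) (b := Atom Y) f Z ∘ h).
Proof. by rewrite !compA (strict_nat (a := Atom X) (b := Atom Y)). Qed.

Lemma stackP_nat K L K' L' Kt Lt Kt' Lt' x y z (f : hom K Kt) (g : hom L Lt) (f' : hom K' Kt')
    (g' : hom L' Lt') (P : hom x (K ⊗ (y ⊗ L))) (P' : hom y (K' ⊗ (z ⊗ L'))) :
  stackP ((f ⊗m (idm y ⊗m g)) ∘ P) ((f' ⊗m (idm z ⊗m g')) ∘ P')
  = ((f ⊗m f') ⊗m (idm z ⊗m (g' ⊗m g))) ∘ stackP P P'.
Proof.
rewrite /stackP; strictify; rewrite !strict_slide.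
(* What is left is to move [g], on the strand to the right of P', past P'. *)
have := strict_nat (a := Atom y) (b := Tens (Atom K') (Tens (Atom z) (Atom L'))) P'
  (strict (a := Atom L) (b := Atom Lt) g unit_obj).
cbn => eP; have := congr1 (tensm (idm Kt)) eP; rewrite !lw_comp => {}eP.
by rewrite (comp_square _ eP).
Qed.

Lemma stackU_nat K L K' L' Kt Lt Kt' Lt' x y z (f : hom K Kt) (g : hom L Lt) (f' : hom K' Kt')
    (g' : hom L' Lt') (U : hom (Kt ⊗ (y ⊗ Lt)) x) (U' : hom (Kt' ⊗ (z ⊗ Lt')) y) :
  stackU (U ∘ (f ⊗m (idm y ⊗m g))) (U' ∘ (f' ⊗m (idm z ⊗m g')))
  = stackU U U' ∘ ((f ⊗m f') ⊗m (idm z ⊗m (g' ⊗m g))).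
Proof.
(* The change of the inner strands is absorbed into U' first, so that only [f] and [g] remain. *)
have -> : (f ⊗m f') ⊗m (idm z ⊗m (g' ⊗m g))
    = ((idm Kt ⊗m f') ⊗m (idm z ⊗m (g' ⊗m idm Lt)))
      ∘ ((f ⊗m idm K') ⊗m (idm z ⊗m (idm L' ⊗m g))).
  by rewrite -!tensm_comp !compm1 !comp1m.
rewrite compA.
have <- : stackU U (U' ∘ (f' ⊗m (idm z ⊗m g')))
    = stackU U U' ∘ ((idm Kt ⊗m f') ⊗m (idm z ⊗m (g' ⊗m idm Lt))).
  by rewrite /stackU; strictify.
move: (U' ∘ _) => {U' g' f'} U'; rewrite /stackU; strictify.
rewrite -[LHS]compm1 -[RHS]compm1 -!compA !strict_slide.
have := strict_nat (a := Tens (Atom K') (Tens (Atom z) (Atom L'))) (b := Atom y) U'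
  (strict (a := Atom L) (b := Atom Lt) g unit_obj).
cbn => eP; have := congr1 (tensm (idm Kt)) eP; rewrite !lw_comp => {}eP.
by rewrite (comp_square _ eP).
Qed.

Lemma stackL_nat K0 K1 K0' K1' Kt0 Kt1 Kt0' Kt1' A B E
    (f : hom K0 Kt0) (g : hom K1 Kt1) (f' : hom K0' Kt0') (g' : hom K1' Kt1')
    (L : hom (K0 ⊗ B) (A ⊗ K1)) (L' : hom (K0' ⊗ E) (B ⊗ K1'))
    (Lt : hom (Kt0 ⊗ B) (A ⊗ Kt1)) (Lt' : hom (Kt0' ⊗ E) (B ⊗ Kt1')) :
  Lt ∘ (f ⊗m idm B) = (idm A ⊗m g) ∘ L ->
  Lt' ∘ (f' ⊗m idm E) = (idm B ⊗m g') ∘ L' ->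
  stackL Lt Lt' ∘ ((f ⊗m f') ⊗m idm E) = (idm A ⊗m (g ⊗m g')) ∘ stackL L L'.
Proof.
move=> eL eL'.
(* In the stack the strand [Kt1'] runs to the right of L, while nothing is to the right of L'. Each
   square is evaluated at the tail at which it occurs. *)
have {}eL := congr1 (fun h => strict
  (a := Tens (Atom K0) (Atom B)) (b := Tens (Atom A) (Atom Kt1)) h (Kt1' ⊗ unit_obj)) eL.
have {}eL' := congr1 (fun h => strict
  (a := Tens (Atom K0') (Atom E)) (b := Tens (Atom B) (Atom Kt1')) h unit_obj) eL'.
cbn beta in eL, eL'; move: eL eL'; strict_push => eL eL'.
rewrite /stackL; strictify.
rewrite -[LHS]compm1 -[RHS]compm1 -!compA -strict_slide (comp_square _ eL).
have {}eL' := congr1 (tensm (idm K0)) eL'; move: eL'; rewrite !lw_comp => eL'.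
rewrite (comp_square _ eL'); congr (_ ∘ _).
have := strict_nat (a := Tens (Atom K0) (Atom B)) (b := Tens (Atom A) (Atom K1)) L
  (strict (a := Atom K1') (b := Atom Kt1') g' unit_obj).
by cbn => e; rewrite (comp_square _ e).
Qed.

Lemma stackR_nat K0 K1 K0' K1' Kt0 Kt1 Kt0' Kt1' A B E
    (f : hom K0 Kt0) (g : hom K1 Kt1) (f' : hom K0' Kt0') (g' : hom K1' Kt1')
    (L : hom (B ⊗ K0) (K1 ⊗ A)) (L' : hom (E ⊗ K0') (K1' ⊗ B))
    (Lt : hom (B ⊗ Kt0) (Kt1 ⊗ A)) (Lt' : hom (E ⊗ Kt0') (Kt1' ⊗ B)) :
  Lt ∘ (idm B ⊗m f) = (g ⊗m idm A) ∘ L ->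
  Lt' ∘ (idm E ⊗m f') = (g' ⊗m idm B) ∘ L' ->
  stackR Lt Lt' ∘ (idm E ⊗m (f' ⊗m f)) = ((g' ⊗m g) ⊗m idm A) ∘ stackR L L'.
Proof.
move=> eL eL'.
have {}eL := congr1 (fun h => strict
  (a := Tens (Atom B) (Atom K0)) (b := Tens (Atom Kt1) (Atom A)) h unit_obj) eL.
have {}eL' := congr1 (fun h => strict
  (a := Tens (Atom E) (Atom K0')) (b := Tens (Atom Kt1') (Atom B)) h (Kt0 ⊗ unit_obj)) eL'.
cbn beta in eL, eL'; move: eL eL'; strict_push => eL eL'.
rewrite /stackR; strictify.
rewrite -[LHS]compm1 -[RHS]compm1 -!compA (comp_square _ eL').
have := strict_nat (a := Tens (Atom E) (Atom K0')) (b := Tens (Atom K1') (Atom B)) L'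
  (strict (a := Atom K0) (b := Atom Kt0) f unit_obj).
cbn => e; rewrite (comp_square _ e) !strict_slide.
have := congr1 (tensm (idm Kt1')) eL; rewrite !lw_comp => {}eL.
by rewrite (comp_square _ eL) -!strict_slide.
Qed.

Lemma stackP_1l K L x y (P : hom x (K ⊗ (y ⊗ L))) :
  stackP (luniti _ ∘ runiti x) P = (luniti K ⊗m (idm y ⊗m runiti L)) ∘ P.
Proof. by rewrite /stackP; strictify. Qed.
Lemma stackP_1r K L x y (P : hom x (K ⊗ (y ⊗ L))) :
  stackP P (luniti _ ∘ runiti y) = (runiti K ⊗m (idm y ⊗m luniti L)) ∘ P.
Proof. by rewrite /stackP; strictify. Qed.
Lemma stackU_1l K L x y (U : hom (K ⊗ (y ⊗ L)) x) :
  U = stackU (runit x ∘ lunit _) U ∘ (luniti K ⊗m (idm y ⊗m runiti L)).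
Proof. by rewrite /stackU; strictify. Qed.
Lemma stackU_1r K L x y (U : hom (K ⊗ (y ⊗ L)) x) :
  U = stackU U (runit y ∘ lunit _) ∘ (runiti K ⊗m (idm y ⊗m luniti L)).
Proof. by rewrite /stackU; strictify. Qed.
Lemma stackL_1l K0 K1 A B (L : hom (K0 ⊗ B) (A ⊗ K1)) :
  stackL (runiti A ∘ lunit A) L ∘ (luniti K0 ⊗m idm B) = (idm A ⊗m luniti K1) ∘ L.
Proof. by rewrite /stackL; strictify. Qed.
Lemma stackL_1r K0 K1 A B (L : hom (K0 ⊗ B) (A ⊗ K1)) :
  stackL L (runiti B ∘ lunit B) ∘ (runiti K0 ⊗m idm B) = (idm A ⊗m runiti K1) ∘ L.
Proof. by rewrite /stackL; strictify. Qed.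
Lemma stackR_1l K0 K1 A B (L : hom (B ⊗ K0) (K1 ⊗ A)) :
  stackR (luniti A ∘ runit A) L ∘ (idm B ⊗m runiti K0) = (runiti K1 ⊗m idm A) ∘ L.
Proof. by rewrite /stackR; strictify. Qed.
Lemma stackR_1r K0 K1 A B (L : hom (B ⊗ K0) (K1 ⊗ A)) :
  stackR L (luniti B ∘ runit B) ∘ (idm B ⊗m luniti K0) = (luniti K1 ⊗m idm A) ∘ L.
Proof. by rewrite /stackR; strictify. Qed.

(** A morphism on the circle between the two diagrams may be attributed to either of them. The
    factorization of the unit splits each inserted composite in this way. *)
Lemma stackP_slide K L K' L' x y y' z (P : hom x (K ⊗ (y ⊗ L))) (f : hom y y')
    (P' : hom y' (K' ⊗ (z ⊗ L'))) :
  stackP ((idm K ⊗m (f ⊗m idm L)) ∘ P) P' = stackP P (P' ∘ f).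
Proof. by rewrite /stackP; strictify. Qed.
Lemma stackL_slide K0 K1 K0' K1' A B B' E (L : hom (K0 ⊗ B) (A ⊗ K1)) (f : hom B' B)
    (L' : hom (K0' ⊗ E) (B' ⊗ K1')) :
  stackL (L ∘ (idm K0 ⊗m f)) L' = stackL L ((f ⊗m idm K1') ∘ L').
Proof. by rewrite /stackL; strictify. Qed.
Lemma stackR_slide K0 K1 K0' K1' A B B' E (R : hom (B ⊗ K0) (K1 ⊗ A)) (f : hom B' B)
    (R' : hom (E ⊗ K0') (K1' ⊗ B')) :
  stackR (R ∘ (f ⊗m idm K0)) R' = stackR R ((idm K1' ⊗m f) ∘ R').
Proof. by rewrite /stackR; strictify. Qed.

Section Snake.
Variables (x A A' B B' : D).
Variables (ev : hom (A' ⊗ A) unit_obj) (coev : hom unit_obj (A ⊗ A')).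
Variables (ev' : hom (B ⊗ B') unit_obj) (coev' : hom unit_obj (B' ⊗ B)).
Hypothesis snakeA :
  runit A ∘ (idm A ⊗m ev) ∘ assoc A A' A ∘ (coev ⊗m idm A) ∘ luniti A = idm A.
Hypothesis snakeB :
  lunit B ∘ (ev' ⊗m idm B) ∘ associ B B' B ∘ (idm B ⊗m coev') ∘ runiti B = idm B.

(** Pairs [A ⊗ A'] and [B' ⊗ B] are created beside x. The outer A and B serve as internal strands,
    and what lies between them is the new bottom line. *)
Definition bend : hom x (A ⊗ ((A' ⊗ (x ⊗ B')) ⊗ B)) :=
  (idm A ⊗m (associ A' (x ⊗ B') B ∘ (idm A' ⊗m associ x B' B)))
    ∘ assoc A A' (x ⊗ (B' ⊗ B)) ∘ (coev ⊗m (idm x ⊗m coev')) ∘ (luniti _ ∘ runiti x).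

Lemma stackP_bend :
  stackP bend (idm (A' ⊗ (x ⊗ B'))) = (coev ⊗m (idm x ⊗m coev')) ∘ (luniti _ ∘ runiti x).
Proof. by rewrite /stackP /bend; strictify. Qed.

(** The inner diagram closes its legs [A] against the strand [A'] by [ev]; with the [coev] created
    at the bottom this is a zigzag, straightened by [snakeA]. *)
Lemma stackL_bend :
  stackL (idm (A ⊗ unit_obj)) (runiti unit_obj ∘ ev) ∘ (coev ⊗m idm A)
  = (idm A ⊗m luniti unit_obj) ∘ (runiti A ∘ lunit A).
Proof.
have := congr1 (fun h => strict (a := Atom A) (b := Atom A) h unit_obj) snakeA.
cbn beta; strict_push => e; rewrite /stackL; strictify; exact: e.
Qed.

Lemma stackR_bend :
  stackR (idm (unit_obj ⊗ B)) (luniti unit_obj ∘ ev') ∘ (idm B ⊗m coev')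
  = (luniti unit_obj ⊗m idm B) ∘ (luniti B ∘ runit B).
Proof.
have := congr1 (fun h => strict (a := Atom B) (b := Atom B) h unit_obj) snakeB.
cbn beta; strict_push => e; rewrite /stackR; strictify; exact: e.
Qed.

Lemma stackU_bend :
  runit x ∘ lunit _ = stackU (runit x ∘ lunit _) (runit x ∘ lunit _)
    ∘ (luniti unit_obj ⊗m (idm x ⊗m luniti unit_obj)).
Proof. by rewrite /stackU; strictify. Qed.

End Snake.

Lemma stackP_bil K L K' L' x y z : bilinear_for *:%R *:%R (@stackP K L K' L' x y z).
Proof.
split=> u k f g; rewrite /stackP.
  by rewrite compmD compmZ.
rewrite [((k *: f + g) ⊗m _)]((tensm_bil _ _ _ _).1 (idm _) k f g).
rewrite [idm _ ⊗m (_ + _)]((tensm_bil _ _ _ _).2 (idm _) k).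
by rewrite !(compmD, compmZ, compDm, compZm).
Qed.

Lemma stackU_bil K L K' L' x y z : bilinear_for *:%R *:%R (@stackU K L K' L' x y z).
Proof.
split=> u k f g; rewrite /stackU.
  by rewrite !(compDm, compZm).
rewrite [((k *: f + g) ⊗m _)]((tensm_bil _ _ _ _).1 (idm _) k f g).
rewrite [idm _ ⊗m (_ + _)]((tensm_bil _ _ _ _).2 (idm _) k).
by rewrite !(compmD, compmZ, compDm, compZm).
Qed.

Lemma stackL_bil K0 K1 K0' K1' A B E :
  bilinear_for *:%R *:%R (@stackL K0 K1 K0' K1' A B E).
Proof.
split=> u k f g; rewrite /stackL.
  rewrite [((k *: f + g) ⊗m _)]((tensm_bil _ _ _ _).1 (idm _) k f g).
  by rewrite !(compmD, compmZ, compDm, compZm).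
rewrite [idm _ ⊗m (_ + _)]((tensm_bil _ _ _ _).2 (idm _) k).
by rewrite !(compmD, compmZ, compDm, compZm).
Qed.

Lemma stackR_bil K0 K1 K0' K1' A B E :
  bilinear_for *:%R *:%R (@stackR K0 K1 K0' K1' A B E).
Proof.
split=> u k f g; rewrite /stackR.
  rewrite [idm _ ⊗m (_ + _)]((tensm_bil _ _ _ _).2 (idm _) k).
  by rewrite !(compmD, compmZ, compDm, compZm).
rewrite [((k *: f + g) ⊗m _)]((tensm_bil _ _ _ _).1 (idm _) k f g).
by rewrite !(compmD, compmZ, compDm, compZm).
Qed.

End Stacking.

(** * Multilinear maps on tensor products in coordinates *)

Section TensorLift.
Variables (C : fieldType).

(** For bare functions whose linearity is only a proposition, which is the form in which all
    multilinear families below occur. *)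
Lemma linear_sum_of (U V : lmodType C) (f : U -> V) : linear f ->
  forall (J : Type) (r : seq J) (P : pred J) (F : J -> U),
  f (\sum_(j <- r | P j) F j) = \sum_(j <- r | P j) f (F j).
Proof.
move=> fl J r P F.
have fD : {morph f : x y / x + y} by move=> x y; have := fl 1 x y; rewrite !scale1r.
have f0 : f 0 = 0 by apply: (addIr (f 0)); rewrite -fD !add0r.
exact: (big_morph f fD f0).
Qed.

Lemma linear_scale_of (U V : lmodType C) (f : U -> V) : linear f ->
  forall k u, f (k *: u) = k *: f u.
Proof.
move=> fl k u.
have fD : {morph f : x y / x + y} by move=> x y; have := fl 1 x y; rewrite !scale1r.
have f0 : f 0 = 0 by apply: (addIr (f 0)); rewrite -fD !add0r.
by have := fl k u 0; rewrite f0 !addr0.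
Qed.

Lemma linear_big (U V : lmodType C) (J : Type) (r : seq J) (P : pred J) (F : J -> U -> V) :
  (forall j, linear (F j)) -> linear (fun u => \sum_(j <- r | P j) F j u).
Proof.
move=> Fl k u v; rewrite scaler_sumr -big_split /=.
by apply: eq_bigr => j _; rewrite Fl.
Qed.

Lemma bilinear_big (U V W : lmodType C) (J : Type) (r : seq J) (P : pred J)
    (F : J -> U -> V -> W) :
  (forall j, bilinear_for *:%R *:%R (F j)) ->
  bilinear_for *:%R *:%R (fun u v => \sum_(j <- r | P j) F j u v).
Proof.
by move=> Fb; split=> w; apply: linear_big => j; [exact: (Fb j).1|exact: (Fb j).2].
Qed.

Lemma bilinear_comp (U U' V V' W : lmodType C) (B : U' -> V' -> W) (f : U -> U') (g : V -> V') :
  bilinear_for *:%R *:%R B -> linear f -> linear g ->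
  bilinear_for *:%R *:%R (fun u v => B (f u) (g v)).
Proof.
move=> Bb fl gl; split=> w k x y /=; first by rewrite fl (bilPl Bb).
by rewrite gl (bilPr Bb).
Qed.

Section Lift.
Variables (V W : vectType C).

Lemma tensv_lift_fun_linear (Z : lmodType C) (f g h : V -> W -> Z) k t :
  (forall v w, h v w = k *: f v w + g v w) ->
  tensv_lift h t = k *: tensv_lift f t + tensv_lift g t.
Proof.
move=> hE; rewrite /tensv_lift scaler_sumr -big_split; apply: eq_bigr => i _ /=.
rewrite scaler_sumr -big_split; apply: eq_bigr => j _ /=.
by rewrite hE scalerDr !scalerA mulrC.
Qed.

Lemma tensv_lift_fun_sum (Z : lmodType C) (J : Type) (r : seq J) (P : pred J)
    (F : J -> V -> W -> Z) t :
  tensv_lift (fun v w => \sum_(j <- r | P j) F j v w) t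
  = \sum_(j <- r | P j) tensv_lift (F j) t.
Proof.
rewrite /tensv_lift [RHS]exchange_big; apply: eq_bigr => i _ /=.
rewrite [RHS]exchange_big; apply: eq_bigr => j _ /=.
by rewrite scaler_sumr.
Qed.

Lemma tensv_lift_ext (Z : lmodType C) (f g : V -> W -> Z) t :
  (forall v w, f v w = g v w) -> tensv_lift f t = tensv_lift g t.
Proof.
by move=> fg; apply: eq_bigr => i _; apply: eq_bigr => j _; rewrite fg.
Qed.

Lemma linear_tensv_lift (Z Z' : lmodType C) (phi : Z -> Z') (f : V -> W -> Z) t :
  linear phi -> phi (tensv_lift f t) = tensv_lift (fun v w => phi (f v w)) t.
Proof.
move=> phil; rewrite (linear_sum_of phil); apply: eq_bigr => i _.
rewrite (linear_sum_of phil); apply: eq_bigr => j _.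
by rewrite (linear_scale_of phil).
Qed.

Lemma tensv_lift_id (t : tensv V W) : tensv_lift (@ptens C V W) t = t.
Proof. by rewrite [RHS]tensv_sum_ptens. Qed.

End Lift.

Section Lift4.
Variables (V1 V2 V3 V4 : vectType C).

Record multilinear4 (Z : lmodType C) (f : V1 -> V2 -> V3 -> V4 -> Z) : Prop :=
  Multilinear4 {
    ml1 : forall b c d, linear (fun a => f a b c d);
    ml2 : forall a c d, linear (fun b => f a b c d);
    ml3 : forall a b d, linear (fun c => f a b c d);
    ml4 : forall a b c, linear (fun d => f a b c d) }.

Lemma lift4_linear (Z : lmodType C) (f : V1 -> V2 -> V3 -> V4 -> Z) : linear (lift4 f).
Proof. exact: tensv_lift_linear. Qed.

Lemma lift4_ext (Z : lmodType C) (f g : V1 -> V2 -> V3 -> V4 -> Z) t :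
  (forall a b c d, f a b c d = g a b c d) -> lift4 f t = lift4 g t.
Proof. by move=> fg; do 3!apply: tensv_lift_ext => ??. Qed.

Lemma lift4_fun_linear (Z : lmodType C) (f g h : V1 -> V2 -> V3 -> V4 -> Z) k t :
  (forall a b c d, h a b c d = k *: f a b c d + g a b c d) ->
  lift4 h t = k *: lift4 f t + lift4 g t.
Proof. by move=> hE; do 3!apply: tensv_lift_fun_linear => ??. Qed.

Lemma lift4_fun0 (Z : lmodType C) (f : V1 -> V2 -> V3 -> V4 -> Z) t :
  (forall a b c d, f a b c d = 0) -> lift4 f t = 0.
Proof.
move=> f0; have := @lift4_fun_linear Z f f f 1 t.
rewrite scale1r => /(_ _)/eqP; rewrite -subr_eq subrr eq_sym => H; apply/eqP/H => a b c d.
by rewrite !f0 scaler0 addr0.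
Qed.

Lemma lift4_fun_sum (Z : lmodType C) (J : Type) (r : seq J) (P : pred J)
    (F : J -> V1 -> V2 -> V3 -> V4 -> Z) t :
  lift4 (fun a b c d => \sum_(j <- r | P j) F j a b c d) t
  = \sum_(j <- r | P j) lift4 (F j) t.
Proof.
rewrite /lift4 -tensv_lift_fun_sum; apply: tensv_lift_ext => a t1.
rewrite -tensv_lift_fun_sum; apply: tensv_lift_ext => b t2.
by rewrite -tensv_lift_fun_sum; apply: tensv_lift_ext => c d.
Qed.

Lemma linear_lift4 (Z Z' : lmodType C) (phi : Z -> Z') (f : V1 -> V2 -> V3 -> V4 -> Z) t :
  linear phi -> phi (lift4 f t) = lift4 (fun a b c d => phi (f a b c d)) t.
Proof.
move=> phil; rewrite linear_tensv_lift //; apply: tensv_lift_ext => a t1.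
rewrite linear_tensv_lift //; apply: tensv_lift_ext => b t2.
by rewrite linear_tensv_lift.
Qed.

Definition ptens4 a b c d : tensv V1 (tensv V2 (tensv V3 V4)) :=
  ptens a (ptens b (ptens c d)).

Lemma ptens4_ml : multilinear4 ptens4.
Proof.
split=> a b c k x y; rewrite /ptens4; have B := ptens_bilinear;
  by do ?rewrite (bilPl (@B _ _ _)) || rewrite (bilPr (@B _ _ _)).
Qed.

Lemma lift4_ptens (Z : lmodType C) (f : V1 -> V2 -> V3 -> V4 -> Z) a b c d :
  multilinear4 f -> lift4 f (ptens4 a b c d) = f a b c d.
Proof.
move=> fl; rewrite /lift4 /ptens4 tensv_lift_ptens; last first.
  split=> [t|v] k x y /=; last exact: tensv_lift_linear.
  do 2!apply: tensv_lift_fun_linear => ??; exact: (ml1 fl).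
rewrite tensv_lift_ptens; last first.
  split=> [t|v] k x y /=; last exact: tensv_lift_linear.
  apply: tensv_lift_fun_linear => ??; exact: (ml2 fl).
by rewrite tensv_lift_ptens //; split=> v k x y /=; [exact: (ml3 fl)|exact: (ml4 fl)].
Qed.

Lemma lift4_id t : lift4 ptens4 t = t.
Proof.
rewrite -[RHS]tensv_lift_id; apply: tensv_lift_ext => a t1.
rewrite -[in RHS](tensv_lift_id t1) 
  (linear_tensv_lift (Z := tensv V2 (tensv V3 V4)) _ t1 (phi := ptens a));
  last exact: (ptens_bilinear _ _).2.
apply: tensv_lift_ext => b t2.
rewrite -[in RHS](tensv_lift_id t2) 
  (linear_tensv_lift _ t2 (phi := fun t => ptens a (ptens b t))) // => k x y.
by rewrite /= (bilPr (@ptens_bilinear _ _ _)) (bilPr (@ptens_bilinear _ _ _)).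
Qed.

Section Slots.
Variables (Z : lmodType C) (f : V1 -> V2 -> V3 -> V4 -> Z).
Hypothesis fl : multilinear4 f.
Lemma ml_bil12 c d : bilinear_for *:%R *:%R (fun a b => f a b c d).
Proof. by split=> x; [exact: (ml1 fl)|exact: (ml2 fl)]. Qed.
Lemma ml_bil13 b d : bilinear_for *:%R *:%R (fun a c => f a b c d).
Proof. by split=> x; [exact: (ml1 fl)|exact: (ml3 fl)]. Qed.
Lemma ml_bil24 a c : bilinear_for *:%R *:%R (fun b d => f a b c d).
Proof. by split=> x; [exact: (ml2 fl)|exact: (ml4 fl)]. Qed.
Lemma ml_bil34 a b : bilinear_for *:%R *:%R (fun c d => f a b c d).
Proof. by split=> x; [exact: (ml3 fl)|exact: (ml4 fl)]. Qed.
Lemma ml_sum1 (J : Type) (r : seq J) (P : pred J) (F : J -> V1) b c d :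
  f (\sum_(j <- r | P j) F j) b c d = \sum_(j <- r | P j) f (F j) b c d.
Proof. exact: (linear_sum_of (ml1 fl b c d)). Qed.
Lemma ml_sum2 (J : Type) (r : seq J) (P : pred J) (F : J -> V2) a c d :
  f a (\sum_(j <- r | P j) F j) c d = \sum_(j <- r | P j) f a (F j) c d.
Proof. exact: (linear_sum_of (ml2 fl a c d)). Qed.
Lemma ml_sum3 (J : Type) (r : seq J) (P : pred J) (F : J -> V3) a b d :
  f a b (\sum_(j <- r | P j) F j) d = \sum_(j <- r | P j) f a b (F j) d.
Proof. exact: (linear_sum_of (ml3 fl a b d)). Qed.
Lemma ml_sum4 (J : Type) (r : seq J) (P : pred J) (F : J -> V4) a b c :
  f a b c (\sum_(j <- r | P j) F j) = \sum_(j <- r | P j) f a b c (F j).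
Proof. exact: (linear_sum_of (ml4 fl a b c)). Qed.
End Slots.

End Lift4.
End TensorLift.

(** * Dinaturality of quadruples *)

Section QuadTheory.
Variables (C : numClosedFieldType) (D : moncat C) (I : finType) (irr : I -> D).
Hypothesis ssD : is_semisimple D.
Hypothesis irrP : is_Irr irr.

Lemma tensPm (X X' Y Y' : D) k (f g : hom X X') (h : hom Y Y') :
  (k *: f + g) ⊗m h = k *: (f ⊗m h) + g ⊗m h.
Proof. exact: (tensm_bil _ _ _ _).1. Qed.
Lemma tensmP (X X' Y Y' : D) k (f : hom X X') (g h : hom Y Y') :
  f ⊗m (k *: g + h) = k *: (f ⊗m g) + f ⊗m h.
Proof. exact: (tensm_bil _ _ _ _).2. Qed.
Lemma compPm (X Y Z : D) k (f g : hom Y Z) (h : hom X Y) :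
  (k *: f + g) ∘ h = k *: (f ∘ h) + g ∘ h.
Proof. by rewrite compDm compZm. Qed.
Lemma compmP (X Y Z : D) k (f : hom Y Z) (g h : hom X Y) :
  f ∘ (k *: g + h) = k *: (f ∘ g) + f ∘ h.
Proof. by rewrite compmD compmZ. Qed.

Section Sums.
Variables (W : lmodType C).

Lemma exchange_big2 (J1 J2 J : finType) (T : J1 -> J2 -> J -> W) :
  \sum_a \sum_b \sum_j T a b j = \sum_j \sum_a \sum_b T a b j.
Proof. by rewrite [RHS]exchange_big; apply: eq_bigr => a _; exact: exchange_big. Qed.

Lemma exchange_big3 (J1 J2 J3 J : finType) (T : J1 -> J2 -> J3 -> J -> W) :
  \sum_a \sum_b \sum_c \sum_j T a b c j = \sum_j \sum_a \sum_b \sum_c T a b c j.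
Proof. by rewrite [RHS]exchange_big; apply: eq_bigr => a _; exact: exchange_big2. Qed.

(** Brings each sum over labels next to the sum over its basis, so that every pair becomes a
    resolution of the identity. *)
Lemma sum_interleave (n0 n1 n2 n3 : I -> nat)
    (T : forall k0 (p0 : 'I_(n0 k0)) k1 (p1 : 'I_(n1 k1))
      k2 (p2 : 'I_(n2 k2)) k3 (p3 : 'I_(n3 k3)), W) :
  \sum_k0 \sum_k1 \sum_k2 \sum_k3 \sum_p0 \sum_p1 \sum_p2 \sum_p3 T k0 p0 k1 p1 k2 p2 k3 p3
  = \sum_k0 \sum_p0 \sum_k1 \sum_p1 \sum_k2 \sum_p2 \sum_k3 \sum_p3 T k0 p0 k1 p1 k2 p2 k3 p3.
Proof.
apply: eq_bigr => k0 _; rewrite exchange_big3; apply: eq_bigr => p0 _.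
apply: eq_bigr => k1 _; rewrite exchange_big2; apply: eq_bigr => p1 _.
by apply: eq_bigr => k2 _; rewrite exchange_big.
Qed.

End Sums.

Section Family.
Variables (m s n t : nat) (o : circle I s t) (i : circle I m n) (Z : lmodType C).

Definition family := forall K0 K1 L0 L1 : D, homP irr o i K0 L0 -> homL irr o i K0 K1 ->
  homR irr o i L0 L1 -> homU irr o i K1 L1 -> Z.

Definition multilinear_family (Phi : family) :=
  forall K0 K1 L0 L1, multilinear4 (Phi K0 K1 L0 L1).

(* [Phi] takes the same value on two quadruples related by morphisms of their
   internal strands. *)
Definition dinatural (Phi : family) := forall K0 K1 L0 L1 K0' K1' L0' L1'
    (f0 : hom K0 K0') (f1 : hom K1 K1') (g0 : hom L0 L0') (g1 : hom L1 L1')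
    (P : homP irr o i K0 L0) (L : homL irr o i K0 K1)
    (R : homR irr o i L0 L1) (U : homU irr o i K1 L1)
    (P' : homP irr o i K0' L0') (L' : homL irr o i K0' K1')
    (R' : homR irr o i L0' L1') (U' : homU irr o i K1' L1'),
  P' = (f0 ⊗m (idm (bot irr i) ⊗m g0)) ∘ P ->
  L' ∘ (f0 ⊗m idm (llegs irr i)) = (idm (llegs irr o) ⊗m f1) ∘ L ->
  R' ∘ (idm (rlegs irr i) ⊗m g0) = (g1 ⊗m idm (rlegs irr o)) ∘ R ->
  U = U' ∘ (f1 ⊗m (idm (top irr i) ⊗m g1)) ->
  Phi K0 K1 L0 L1 P L R U = Phi K0' K1' L0' L1' P' L' R' U'.

(* [tube_at] is the coend of the quadruples: a multilinear dinatural family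
   extends uniquely along [quad], see [extend_quad] and [tube_linear_ext]. *)
Definition extend (Phi : family) (X : tube_at irr o i) : Z :=
  \sum_(k0 : I) \sum_(k1 : I) \sum_(l0 : I) \sum_(l1 : I)
    lift4 (Phi (irr k0) (irr k1) (irr l0) (irr l1)) (X (k0, k1, l0, l1)).

Lemma extend_linear Phi : linear (extend Phi).
Proof.
do 4!apply: linear_big => ?; move=> k X Y.
by rewrite !ffunE; exact: lift4_linear.
Qed.

End Family.

Variables (m s n t : nat) (o : circle I s t) (i : circle I m n).

Section QuadTerm.
Variables (K0 K0' K1 K1' L0 L0' L1 L1' : D) (k0 k1 l0 l1 : I).
Variables (P : homP irr o i K0 L0) (L : homL irr o i K0' K1).
Variables (R : homR irr o i L0' L1) (U : homU irr o i K1' L1').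

(** A summand of [quad] with arbitrary morphisms in place of [p^*] and [p]. The two ends of a strand
    may be different objects, as they are when a morphism on it is not yet assigned to a vertex. *)
Definition quad_term (a0 : hom K0 (irr k0)) (b0 : hom (irr k0) K0')
    (a1 : hom K1 (irr k1)) (b1 : hom (irr k1) K1')
    (c0 : hom L0 (irr l0)) (d0 : hom (irr l0) L0')
    (c1 : hom L1 (irr l1)) (d1 : hom (irr l1) L1') : tube_summand irr o i (k0, k1, l0, l1) :=
  ptens4 ((a0 ⊗m (idm (bot irr i) ⊗m c0)) ∘ P)
         ((idm (llegs irr o) ⊗m a1) ∘ L ∘ (b0 ⊗m idm (llegs irr i)))
         ((c1 ⊗m idm (rlegs irr o)) ∘ R ∘ (idm (rlegs irr i) ⊗m d0))
         (U ∘ (b1 ⊗m (idm (top irr i) ⊗m d1))).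

Lemma quad_term_bil0 a1 b1 c0 d0 c1 d1 :
  bilinear_for *:%R *:%R (fun a0 b0 => quad_term a0 b0 a1 b1 c0 d0 c1 d1).
Proof.
apply: (bilinear_comp (ml_bil12 (ptens4_ml _ _ _ _) _ _)
  (f := fun a => (a ⊗m _) ∘ P) (g := fun b => _ ∘ (b ⊗m _))) => k x y /=;
by rewrite ?(tensPm, tensmP, compPm, compmP).
Qed.

Lemma quad_term_bil1 a0 b0 c0 d0 c1 d1 :
  bilinear_for *:%R *:%R (fun a1 b1 => quad_term a0 b0 a1 b1 c0 d0 c1 d1).
Proof.
apply: (bilinear_comp (ml_bil24 (ptens4_ml _ _ _ _) _ _)
  (f := fun a => (_ ⊗m a) ∘ L ∘ _) (g := fun b => U ∘ (b ⊗m _))) => k x y /=;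
by rewrite ?(tensPm, tensmP, compPm, compmP).
Qed.

Lemma quad_term_bil2 a0 b0 a1 b1 c1 d1 :
  bilinear_for *:%R *:%R (fun c0 d0 => quad_term a0 b0 a1 b1 c0 d0 c1 d1).
Proof.
apply: (bilinear_comp (ml_bil13 (ptens4_ml _ _ _ _) _ _)
  (f := fun a => (_ ⊗m (_ ⊗m a)) ∘ P) (g := fun b => _ ∘ (_ ⊗m b))) => k x y /=;
by rewrite ?(tensPm, tensmP, compPm, compmP).
Qed.

Lemma quad_term_bil3 a0 b0 a1 b1 c0 d0 :
  bilinear_for *:%R *:%R (fun c1 d1 => quad_term a0 b0 a1 b1 c0 d0 c1 d1).
Proof.
apply: (bilinear_comp (ml_bil34 (ptens4_ml _ _ _ _) _ _)
  (f := fun a => (a ⊗m _) ∘ R ∘ _) (g := fun b => U ∘ (_ ⊗m (_ ⊗m b)))) => k x y /=;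
by rewrite ?(tensPm, tensmP, compPm, compmP).
Qed.

End QuadTerm.

Lemma quadE K0 K1 L0 L1 (P : homP irr o i K0 L0) (L : homL irr o i K0 K1)
    (R : homR irr o i L0 L1) (U : homU irr o i K1 L1) k0 k1 l0 l1 :
  quad P L R U (k0, k1, l0, l1) =
    \sum_(p0 < \dim {: hom (irr k0) K0}) \sum_(p1 < \dim {: hom (irr k1) K1})
    \sum_(q0 < \dim {: hom (irr l0) L0}) \sum_(q1 < \dim {: hom (irr l1) L1})
      quad_term P L R U
        (dual_basis p0) (vb (hom (irr k0) K0))`_p0 (dual_basis p1) (vb (hom (irr k1) K1))`_p1
        (dual_basis q0) (vb (hom (irr l0) L0))`_q0 (dual_basis q1) (vb (hom (irr l1) L1))`_q1.
Proof. by rewrite ffunE. Qed.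

Lemma quad_ml : @multilinear_family m s n t o i (tube_at irr o i) (@quad C D I irr m s n t o i).
Proof.
move=> K0 K1 L0 L1; split=> a b c k x y; apply/ffunP => -[[[k0 k1] l0] l1];
  rewrite [in RHS]ffunE [X in _ = X + _]ffunE !quadE;
  do 4!(rewrite scaler_sumr -big_split; apply: eq_bigr => ? _ /=);
  rewrite /quad_term ?(compmD, compDm, compmZ, compZm).
- by rewrite (ml1 (ptens4_ml _ _ _ _)).
- by rewrite (ml2 (ptens4_ml _ _ _ _)).
- by rewrite (ml3 (ptens4_ml _ _ _ _)).
by rewrite (ml4 (ptens4_ml _ _ _ _)).
Qed.

(** In this strand the rest of the sum is a bilinear expression in [p^*] and [p], so
    [dual_basis_dinatural] applies. The other three strands are treated alike. *)
Lemma quad_dinat0 K0 K0' K1 L0 L1 (f : hom K0 K0') P L R U :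
  @quad C D I irr m s n t o i K0' K1 L0 L1 ((f ⊗m idm _) ∘ P) L R U
  = quad P (L ∘ (f ⊗m idm _)) R U.
Proof.
apply/ffunP => -[[[k0 k1] l0] l1]; rewrite !quadE.
have psib := bilinear_big (index_enum _) xpredT (fun p1 =>
  bilinear_big (index_enum _) xpredT (fun q0 => bilinear_big (index_enum _) xpredT (fun q1 =>
  quad_term_bil0 k0 P L R U (dual_basis p1) (vb (hom (irr k1) K1))`_p1 (dual_basis q0)
    (vb (hom (irr l0) L0))`_q0 (dual_basis q1) (vb (hom (irr l1) L1))`_q1))).
apply: (etrans _ (etrans (dual_basis_dinatural ssD irrP f psib) _));
  do 4!apply: eq_bigr => ? _; congr ptens4.
  by rewrite compA -tensm_comp compm1.
by rewrite -!compA -tensm_comp comp1m.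
Qed.

Lemma quad_dinat1 K0 K1 K1' L0 L1 (f : hom K1 K1') P L R U :
  @quad C D I irr m s n t o i K0 K1' L0 L1 P ((idm _ ⊗m f) ∘ L) R U
  = quad P L R (U ∘ (f ⊗m idm _)).
Proof.
apply/ffunP => -[[[k0 k1] l0] l1]; rewrite !quadE; apply: eq_bigr => p0 _.
have psib := bilinear_big (index_enum _) xpredT (fun q0 =>
  bilinear_big (index_enum _) xpredT (fun q1 =>
  quad_term_bil1 k1 P L R U (dual_basis p0) (vb (hom (irr k0) K0))`_p0 (dual_basis q0)
    (vb (hom (irr l0) L0))`_q0 (dual_basis q1) (vb (hom (irr l1) L1))`_q1)).
apply: (etrans _ (etrans (dual_basis_dinatural ssD irrP f psib) _));
  do 3!apply: eq_bigr => ? _; congr ptens4.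
  by rewrite compA -tensm_comp compm1.
by rewrite -!compA -tensm_comp comp1m.
Qed.

Lemma quad_dinat2 K0 K1 L0 L0' L1 (f : hom L0 L0') P L R U :
  @quad C D I irr m s n t o i K0 K1 L0' L1 ((idm _ ⊗m (idm _ ⊗m f)) ∘ P) L R U
  = quad P L (R ∘ (idm _ ⊗m f)) U.
Proof.
apply/ffunP => -[[[k0 k1] l0] l1]; rewrite !quadE.
apply: eq_bigr => p0 _; apply: eq_bigr => p1 _.
have psib := bilinear_big (index_enum _) xpredT (fun q1 =>
  quad_term_bil2 l0 P L R U (dual_basis p0) (vb (hom (irr k0) K0))`_p0 (dual_basis p1)
    (vb (hom (irr k1) K1))`_p1 (dual_basis q1) (vb (hom (irr l1) L1))`_q1).
apply: (etrans _ (etrans (dual_basis_dinatural ssD irrP f psib) _));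
  do 2!apply: eq_bigr => ? _; congr ptens4.
  by rewrite compA -!tensm_comp !compm1.
by rewrite -!compA -tensm_comp comp1m.
Qed.

Lemma quad_dinat3 K0 K1 L0 L1 L1' (f : hom L1 L1') P L R U :
  @quad C D I irr m s n t o i K0 K1 L0 L1' P L ((f ⊗m idm _) ∘ R) U
  = quad P L R (U ∘ (idm _ ⊗m (idm _ ⊗m f))).
Proof.
apply/ffunP => -[[[k0 k1] l0] l1]; rewrite !quadE.
apply: eq_bigr => p0 _; apply: eq_bigr => p1 _; apply: eq_bigr => q0 _.
have psib := quad_term_bil3 l1 P L R U (dual_basis p0) (vb (hom (irr k0) K0))`_p0
  (dual_basis p1) (vb (hom (irr k1) K1))`_p1 (dual_basis q0) (vb (hom (irr l0) L0))`_q0.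
apply: (etrans _ (etrans (dual_basis_dinatural ssD irrP f psib) _));
  apply: eq_bigr => ? _; congr ptens4.
  by rewrite compA -!tensm_comp !compm1.
by rewrite -!compA -!tensm_comp !comp1m.
Qed.

Lemma quad_dinatural : dinatural (@quad C D I irr m s n t o i).
Proof.
move=> K0 K1 L0 L1 K0' K1' L0' L1' f0 f1 g0 g1 P L R U P' L' R' U' -> eL eR ->.
have -> : f0 ⊗m (idm (bot irr i) ⊗m g0)
    = (f0 ⊗m idm _) ∘ (idm _ ⊗m (idm (bot irr i) ⊗m g0)) by rewrite -tensm_lr.
(* The morphisms of the lower strands move from P to L and R, the two squares turn them into
   morphisms of the upper strands, and these move on to U. *)
rewrite -compA quad_dinat0 quad_dinat2 eL eR quad_dinat1 quad_dinat3 -compA.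
by rewrite -tensm_lr.
Qed.

End QuadTheory.

(** * Stacking of diagrams with fixed labels *)

Section StackTheory.
Variables (C : numClosedFieldType) (D : moncat C) (I : finType) (irr : I -> D).
Hypothesis ssD : is_semisimple D.
Hypothesis irrP : is_Irr irr.

Section Extend.
Variables (m s n t : nat) (o : circle I s t) (i : circle I m n) (Z : lmodType C).
Variable Phi : family irr o i Z.
Hypothesis Phi_ml : multilinear_family Phi.
Hypothesis Phi_dinat : dinatural Phi.

(** The existence half of the universal property. Dinaturality turns each term of [quad] into [Phi]
    of the original quadruple with some [p ∘ p^*] inserted on every strand, and these sum to the
    identity. *)
Lemma extend_quad K0 K1 L0 L1 P L R U :
  extend Phi (@quad C D I irr m s n t o i K0 K1 L0 L1 P L R U) = Phi P L R U.
Proof.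
rewrite /extend.
pose T k0 (p0 : 'I_(\dim {: hom (irr k0) K0})) k1 (p1 : 'I_(\dim {: hom (irr k1) K1}))
    l0 (q0 : 'I_(\dim {: hom (irr l0) L0})) l1 (q1 : 'I_(\dim {: hom (irr l1) L1})) :=
  Phi P (L ∘ (((vb (hom (irr k0) K0))`_p0 ∘ dual_basis p0) ⊗m idm _))
        (R ∘ (idm _ ⊗m ((vb (hom (irr l0) L0))`_q0 ∘ dual_basis q0)))
        (U ∘ (((vb (hom (irr k1) K1))`_p1 ∘ dual_basis p1)
               ⊗m (idm _ ⊗m ((vb (hom (irr l1) L1))`_q1 ∘ dual_basis q1)))).
transitivity (\sum_k0 \sum_k1 \sum_l0 \sum_l1 \sum_p0 \sum_p1 \sum_q0 \sum_q1
   @T k0 p0 k1 p1 l0 q0 l1 q1).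
  do 4!apply: eq_bigr => ? _; rewrite quadE.
  do 4!(rewrite (linear_sum_of (@lift4_linear _ _ _ _ _ _ _)); apply: eq_bigr => ? _).
  (* Dinaturality is applied along the four dual basis vectors. *)
  rewrite /quad_term lift4_ptens //; apply/esym; apply: Phi_dinat => //.
  - by rewrite -!compA -!tensm_comp !comp1m ?compm1.
  - by rewrite -!compA -!tensm_comp !comp1m ?compm1.
  by rewrite -!compA -!tensm_comp !comp1m ?compm1.
rewrite (sum_interleave T) /T.
have resT X Y Y' (h : hom (X ⊗ Y) Y') : \sum_k \sum_(p < \dim {: hom (irr k) Y}) h ∘ (idm X ⊗m
    ((vb (hom (irr k) Y))`_p ∘ dual_basis p)) = h.
  rewrite -[RHS]compm1 -tensm_id -(resolution ssD irrP Y).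
  rewrite (bil_sumr (@tensm_bil _ _ _ _ _ _)) comp_sumr; apply: eq_bigr => k _.
  by rewrite (bil_sumr (@tensm_bil _ _ _ _ _ _)) comp_sumr.
have resT' X Y Y' (h : hom (Y ⊗ X) Y') : \sum_k \sum_(p < \dim {: hom (irr k) Y}) h ∘ (
    ((vb (hom (irr k) Y))`_p ∘ dual_basis p) ⊗m idm X) = h.
  rewrite -[RHS]compm1 -tensm_id -(resolution ssD irrP Y).
  rewrite (bil_suml (@tensm_bil _ _ _ _ _ _)) comp_sumr; apply: eq_bigr => k _.
  by rewrite (bil_suml (@tensm_bil _ _ _ _ _ _)) comp_sumr.
have resU (X1 X Y Y' : D) (b : hom X1 X1) (h : hom (X1 ⊗ (X ⊗ Y)) Y') :
    \sum_k \sum_(p < \dim {: hom (irr k) Y}) h ∘ (b ⊗m (idm X ⊗m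
    ((vb (hom (irr k) Y))`_p ∘ dual_basis p))) = h ∘ (b ⊗m idm _).
  rewrite -(tensm_id X) -(resolution ssD irrP Y).
  rewrite !(bil_sumr (@tensm_bil _ _ _ _ _ _)) comp_sumr; apply: eq_bigr => k _.
  by rewrite !(bil_sumr (@tensm_bil _ _ _ _ _ _)) comp_sumr.
have expL P' L' R' U' : Phi P' L' R' U' = \sum_k0 \sum_(p0 < \dim {: hom (irr k0) K0})
    Phi P' (L' ∘ (((vb (hom (irr k0) K0))`_p0 ∘ dual_basis p0) ⊗m idm _)) R' U'.
  rewrite -{1}(resT' _ _ _ L') (ml_sum2 (Phi_ml _ _ _ _)); apply: eq_bigr => ? _.
  by rewrite (ml_sum2 (Phi_ml _ _ _ _)).
have expU P' L' R' U' : Phi P' L' R' U' = \sum_k1 \sum_(p1 < \dim {: hom (irr k1) K1})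
    Phi P' L' R' (U' ∘ (((vb (hom (irr k1) K1))`_p1 ∘ dual_basis p1) ⊗m idm _)).
  rewrite -{1}(resT' _ _ _ U') (ml_sum4 (Phi_ml _ _ _ _)); apply: eq_bigr => ? _.
  by rewrite (ml_sum4 (Phi_ml _ _ _ _)).
have expR P' L' R' U' : Phi P' L' R' U' = \sum_l0 \sum_(q0 < \dim {: hom (irr l0) L0})
    Phi P' L' (R' ∘ (idm _ ⊗m ((vb (hom (irr l0) L0))`_q0 ∘ dual_basis q0))) U'.
  rewrite -{1}(resT _ _ _ R') (ml_sum3 (Phi_ml _ _ _ _)); apply: eq_bigr => ? _.
  by rewrite (ml_sum3 (Phi_ml _ _ _ _)).
(* U carries both upper strands, so its second resolution is inserted beside the morphism [b] left
   by the first. *)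
have expU' P' L' R' U' (b : hom K1 K1) : Phi P' L' R' (U' ∘ (b ⊗m idm _)) =
    \sum_l1 \sum_(q1 < \dim {: hom (irr l1) L1})
    Phi P' L' R' (U' ∘ (b ⊗m (idm _ ⊗m ((vb (hom (irr l1) L1))`_q1 ∘ dual_basis q1)))).
  rewrite -{1}resU (ml_sum4 (Phi_ml _ _ _ _)); apply: eq_bigr => ? _.
  by rewrite (ml_sum4 (Phi_ml _ _ _ _)).
rewrite [RHS]expL; do 2!apply: eq_bigr => ? _.
rewrite [RHS]expU; do 2!apply: eq_bigr => ? _.
rewrite [RHS]expR; do 2!apply: eq_bigr => ? _.
by rewrite [RHS]expU'.
Qed.

End Extend.

Section Pure.
Variables (m s n t : nat) (o : circle I s t) (i : circle I m n) (k0 k1 l0 l1 : I).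
Variables (P : homP irr o i (irr k0) (irr l0)) (L : homL irr o i (irr k0) (irr k1))
    (R : homR irr o i (irr l0) (irr l1)) (U : homU irr o i (irr k1) (irr l1)).

Lemma quad_irr_neq k0' k1' l0' l1' :
  ~~ [&& k0 == k0', k1 == k1', l0 == l0' & l1 == l1'] -> quad P L R U (k0', k1', l0', l1') = 0.
Proof.
rewrite !negb_and => ne; rewrite quadE big1 // => p0 _; rewrite big1 // => p1 _.
rewrite big1 // => q0 _; rewrite big1 // => q1 _.
rewrite /quad_term; case/or4P: ne => ne.
- rewrite [dual_basis p0](hom_irr_neq ssD irrP) //.
  by rewrite (bil0l (@tensm_bil _ _ _ _ _ _)) comp0m (bil0l (ml_bil12 (ptens4_ml _ _ _ _) _ _)).
- rewrite [dual_basis p1](hom_irr_neq ssD irrP) //.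
  by rewrite (bil0r (@tensm_bil _ _ _ _ _ _)) !comp0m (bil0r (ml_bil12 (ptens4_ml _ _ _ _) _ _)).
- rewrite [dual_basis q0](hom_irr_neq ssD irrP) //.
  by rewrite !(bil0r (@tensm_bil _ _ _ _ _ _)) comp0m (bil0l (ml_bil12 (ptens4_ml _ _ _ _) _ _)).
rewrite [dual_basis q1](hom_irr_neq ssD irrP) //.
by rewrite !(bil0l (@tensm_bil _ _ _ _ _ _)) !comp0m (bil0l (ml_bil34 (ptens4_ml _ _ _ _) _ _)).
Qed.

(** Endomorphisms of [irr k] are scalars, so [psi a b] depends only on [b ∘ a], and the resolution
    sums these composites to the identity. *)
Lemma irr_basis_sum (k : I) (W : lmodType C)
    (psi : hom (irr k) (irr k) -> hom (irr k) (irr k) -> W) :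
  bilinear_for *:%R *:%R psi ->
  \sum_(p < \dim {: hom (irr k) (irr k)}) psi (dual_basis p) (vb (hom (irr k) (irr k)))`_p
  = psi (idm _) (idm _).
Proof.
move=> psib; have := dual_resolution ssD irrP (idm (irr k)).
under eq_bigr => p _ do rewrite comp1m.
move=> S1.
have bal a b : psi a b = psi (idm _) (b ∘ a).
  have [[c ->] [d ->]] := (hom_irr_eq ssD irrP a, hom_irr_eq ssD irrP b).
  by rewrite compmZ compm1 !(bilZl psib, bilZr psib).
transitivity (psi (idm _) (\sum_(p < \dim {: hom (irr k) (irr k)})
  (vb (hom (irr k) (irr k)))`_p ∘ dual_basis p)); last by rewrite S1.
by rewrite (bil_sumr psib); apply: eq_bigr => p _; exact: bal.
Qed.

Lemma quad_irr_eq : quad P L R U (k0, k1, l0, l1) = ptens4 P L R U.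
Proof.
transitivity (quad_term P L R U (idm _) (idm _) (idm _) (idm _) (idm _) (idm _) (idm _) (idm _)).
  rewrite quadE -(irr_basis_sum (quad_term_bil0 _ _ _ _ _ _ _ _ _ _ _)); apply: eq_bigr => p0 _.
  rewrite -(irr_basis_sum (quad_term_bil1 _ _ _ _ _ _ _ _ _ _ _)); apply: eq_bigr => p1 _.
  rewrite -(irr_basis_sum (quad_term_bil2 _ _ _ _ _ _ _ _ _ _ _)); apply: eq_bigr => q0 _.
  by rewrite -(irr_basis_sum (quad_term_bil3 _ _ _ _ _ _ _ _ _ _ _)).
by rewrite /quad_term !tensm_id !comp1m !compm1.
Qed.

End Pure.

(** By Schur's lemma a quadruple with simple strands is a pure tensor sitting in its own summand, so
    quadruples span. This is the uniqueness half of the universal property. *)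
Lemma extend_quad_id m s n t (o : circle I s t) (i : circle I m n) (X : tube_at irr o i) :
  extend (@quad C D I irr m s n t o i) X = X.
Proof.
apply/ffunP => -[[[k0 k1] l0] l1]; rewrite /extend.
have ev w : linear (fun Y : tube_at irr o i => Y w) by move=> k Y Y'; rewrite !ffunE.
have off j0 j1 h0 h1 t' w : ~~ [&& j0 == w.1.1.1, j1 == w.1.1.2, h0 == w.1.2 & h1 == w.2] ->
    lift4 (@quad C D I irr m s n t o i (irr j0) (irr j1) (irr h0) (irr h1)) t' w = 0.
  case: w => -[[w0 w1] w2] w3 ne; rewrite (linear_lift4 _ _ (ev _)).
  by apply: lift4_fun0 => a b c d; exact: quad_irr_neq.
rewrite (linear_sum_of (ev _)) (bigD1 k0) //= [X in _ + X]big1 ?addr0; last first.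
  move=> j jk; do 3!(rewrite (linear_sum_of (ev _)) big1 // => ? _).
  by rewrite off //= (negPf jk).
rewrite (linear_sum_of (ev _)) (bigD1 k1) //= [X in _ + X]big1 ?addr0; last first.
  move=> j jk; do 2!(rewrite (linear_sum_of (ev _)) big1 // => ? _).
  by rewrite off //= (negPf jk) andbF.
rewrite (linear_sum_of (ev _)) (bigD1 l0) //= [X in _ + X]big1 ?addr0; last first.
  move=> j jk; rewrite (linear_sum_of (ev _)) big1 // => ? _.
  by rewrite off //= (negPf jk) !andbF.
rewrite (linear_sum_of (ev _)) (bigD1 l1) //= [X in _ + X]big1 ?addr0; last first.
  by move=> j jk; rewrite off //= (negPf jk) !andbF.
rewrite (linear_lift4 _ _ (ev _)) -[RHS]lift4_id; apply: lift4_ext => a b c d.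
exact: quad_irr_eq.
Qed.

Lemma linear_extend m s n t (o : circle I s t) (i : circle I m n) (Z Z' : lmodType C)
    (f : Z -> Z') (Phi : family irr o i Z) X : linear f ->
  f (extend Phi X) = extend (fun K0 K1 L0 L1 P L R U => f (Phi K0 K1 L0 L1 P L R U)) X.
Proof.
move=> fl; do 4!(rewrite (linear_sum_of fl); apply: eq_bigr => ? _).
exact: linear_lift4.
Qed.

Lemma extend_ext m s n t (o : circle I s t) (i : circle I m n) (Z : lmodType C)
    (Phi Psi : family irr o i Z) X :
  (forall K0 K1 L0 L1 P L R U, Phi K0 K1 L0 L1 P L R U = Psi K0 K1 L0 L1 P L R U) ->
  extend Phi X = extend Psi X.
Proof. by move=> e; do 4!apply: eq_bigr => ? _; apply: lift4_ext => ????; rewrite e. Qed.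

Lemma tube_linear_ext m s n t (o : circle I s t) (i : circle I m n) (Z : lmodType C)
    (f g : tube_at irr o i -> Z) : linear f -> linear g ->
  (forall K0 K1 L0 L1 P L R U,
     f (@quad C D I irr m s n t o i K0 K1 L0 L1 P L R U) = g (quad P L R U)) ->
  f =1 g.
Proof.
move=> fl gl fg X; rewrite -(extend_quad_id X) !linear_extend //.
exact: extend_ext.
Qed.

Section Stack.
Variables (q m s r n t : nat).
Variables (o : circle I s t) (j : circle I m n) (i : circle I q r).

Definition stack_family K0 K1 L0 L1 (P : homP irr o j K0 L0) (L : homL irr o j K0 K1)
    (R : homR irr o j L0 L1) (U : homU irr o j K1 L1) : family irr j i (tube_at irr o i) :=
  fun K0' K1' L0' L1' P' L' R' U' => stack_quad P L R U P' L' R' U'.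

Lemma stack_quadE K0 K1 L0 L1 (P : homP irr o j K0 L0) (L : homL irr o j K0 K1)
    (R : homR irr o j L0 L1) (U : homU irr o j K1 L1)
    K0' K1' L0' L1' (P' : homP irr j i K0' L0') (L' : homL irr j i K0' K1')
    (R' : homR irr j i L0' L1') (U' : homU irr j i K1' L1') :
  stack_quad P L R U P' L' R' U'
  = @quad C D I irr q s r t o i (K0 ⊗ K0') (K1 ⊗ K1') (L0' ⊗ L0) (L1' ⊗ L1)
      (stackP P P') (stackL L L') (stackR R R') (stackU U U').
Proof. by []. Qed.

Lemma stack_family_ml K0 K1 L0 L1 P L R U : multilinear_family (@stack_family K0 K1 L0 L1 P L R U).
Proof.
move=> K0' K1' L0' L1'; split=> a b c k x y; rewrite /stack_family !stack_quadE.
- by rewrite (bilPr (@stackP_bil _ _ _ _ _ _ _ _ _)) (ml1 (quad_ml _ _ _ _ _ _ _)).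
- by rewrite (bilPr (@stackL_bil _ _ _ _ _ _ _ _ _)) (ml2 (quad_ml _ _ _ _ _ _ _)).
- by rewrite (bilPr (@stackR_bil _ _ _ _ _ _ _ _ _)) (ml3 (quad_ml _ _ _ _ _ _ _)).
by rewrite (bilPr (@stackU_bil _ _ _ _ _ _ _ _ _)) (ml4 (quad_ml _ _ _ _ _ _ _)).
Qed.

Lemma stack_family_dinat K0 K1 L0 L1 P L R U : dinatural (@stack_family K0 K1 L0 L1 P L R U).
Proof.
move=> ???????? f0 f1 g0 g1 P1 L1' R1 U1 P2 L2 R2 U2 eP eL eR eU.
rewrite /stack_family !stack_quadE.
apply: (quad_dinatural ssD irrP (f0 := idm _ ⊗m f0) (f1 := idm _ ⊗m f1)
  (g0 := g0 ⊗m idm _) (g1 := g1 ⊗m idm _)).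
- by rewrite eP -stackP_nat !tensm_id comp1m.
- by apply: stackL_nat; rewrite ?tensm_id ?comp1m ?compm1.
- by apply: stackR_nat; rewrite ?tensm_id ?comp1m ?compm1.
by rewrite eU -stackU_nat !tensm_id compm1.
Qed.

(** Stacking is extended in two stages, first in the inner diagram X' and then in the outer one;
    multilinearity and dinaturality are checked at each stage. *)
Definition stack_with (X' : tube_at irr j i) : family irr o j (tube_at irr o i) :=
  fun K0 K1 L0 L1 P L R U => extend (stack_family P L R U) X'.

Lemma extend_fun_linear m' s' n' t' (o' : circle I s' t') (i' : circle I m' n') (Z : lmodType C)
    (f g h : family irr o' i' Z) k X :
  (forall K0 K1 L0 L1 P L R U,
     h K0 K1 L0 L1 P L R U = k *: f K0 K1 L0 L1 P L R U + g K0 K1 L0 L1 P L R U) ->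
  extend h X = k *: extend f X + extend g X.
Proof.
move=> hE; rewrite /extend; do 4!(rewrite scaler_sumr -big_split; apply: eq_bigr => ? _ /=).
by apply: lift4_fun_linear => ????; rewrite hE.
Qed.

Lemma stack_with_ml X' : multilinear_family (stack_with X').
Proof.
move=> K0 K1 L0 L1; split=> a b c k x y; apply: extend_fun_linear => *;
  rewrite /stack_family !stack_quadE.
- by rewrite (bilPl (@stackP_bil _ _ _ _ _ _ _ _ _)) (ml1 (quad_ml _ _ _ _ _ _ _)).
- by rewrite (bilPl (@stackL_bil _ _ _ _ _ _ _ _ _)) (ml2 (quad_ml _ _ _ _ _ _ _)).
- by rewrite (bilPl (@stackR_bil _ _ _ _ _ _ _ _ _)) (ml3 (quad_ml _ _ _ _ _ _ _)).
by rewrite (bilPl (@stackU_bil _ _ _ _ _ _ _ _ _)) (ml4 (quad_ml _ _ _ _ _ _ _)).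
Qed.

Lemma stack_with_dinat X' : dinatural (stack_with X').
Proof.
move=> ???????? f0 f1 g0 g1 P1 L1' R1 U1 P2 L2 R2 U2 eP eL eR eU.
apply: extend_ext => *; rewrite /stack_family !stack_quadE.
apply: (quad_dinatural ssD irrP (f0 := f0 ⊗m idm _) (f1 := f1 ⊗m idm _)
  (g0 := idm _ ⊗m g0) (g1 := idm _ ⊗m g1)).
- by rewrite eP -stackP_nat !tensm_id comp1m.
- by apply: stackL_nat; rewrite ?tensm_id ?comp1m ?compm1.
- by apply: stackR_nat; rewrite ?tensm_id ?comp1m ?compm1.
by rewrite eU -stackU_nat !tensm_id compm1.
Qed.

Lemma stack_at_extend (X : tube_at irr o j) (X' : tube_at irr j i) :
  stack_at X X' = extend (stack_with X') X.
Proof.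
do 4!apply: eq_bigr => ? _.
(* In [stack_at] the sums over the strands of X' stand outside both lifts, in [stack_with] between
   them. *)
by do 4!(rewrite lift4_fun_sum; apply: eq_bigr => ? _).
Qed.

Lemma stack_at_bil : bilinear_for *:%R *:%R (@stack_at C D I irr q m s r n t o j i).
Proof.
split=> X k Y Y'; rewrite !stack_at_extend; first exact: extend_linear.
by apply: extend_fun_linear => *; exact: extend_linear.
Qed.

Lemma stack_at_quad K0 K1 L0 L1 (P : homP irr o j K0 L0) (L : homL irr o j K0 K1)
    (R : homR irr o j L0 L1) (U : homU irr o j K1 L1)
    K0' K1' L0' L1' (P' : homP irr j i K0' L0') (L' : homL irr j i K0' K1')
    (R' : homR irr j i L0' L1') (U' : homU irr j i K1' L1') :
  stack_at (quad P L R U) (quad P' L' R' U')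
  = @quad C D I irr q s r t o i (K0 ⊗ K0') (K1 ⊗ K1') (L0' ⊗ L0) (L1' ⊗ L1)
      (stackP P P') (stackL L L') (stackR R R') (stackU U U').
Proof.
rewrite stack_at_extend (extend_quad (stack_with_ml _) (stack_with_dinat _)).
exact: (extend_quad (stack_family_ml P L R U) (stack_family_dinat P L R U)).
Qed.

End Stack.

Lemma stack_at_assoc m0 n0 m1 n1 m2 n2 m3 n3 (a : circle I m0 n0) (b : circle I m1 n1)
    (c : circle I m2 n2) (d : circle I m3 n3)
    (X : tube_at irr a b) (Y : tube_at irr b c) (Z : tube_at irr c d) :
  stack_at (stack_at X Y) Z = stack_at X (stack_at Y Z).
Proof.
have lin1 m n s t q r (o : circle I s t) (j : circle I m n) (i : circle I q r)
   (V : tube_at irr j i) : linear (fun W : tube_at irr o j => stack_at W V).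
  by move=> k u v; exact: (bilPl (@stack_at_bil _ _ _ _ _ _ _ _ _)).
have lin2 m n s t q r (o : circle I s t) (j : circle I m n) (i : circle I q r)
   (V : tube_at irr o j) : linear (fun W : tube_at irr j i => stack_at V W).
  by move=> k u v; exact: (bilPr (@stack_at_bil _ _ _ _ _ _ _ _ _)).
move: Z; apply: tube_linear_ext => [k u v|k u v|? ? ? ? P3 L3 R3 U3]; rewrite ?lin2 //.
move: Y; apply: tube_linear_ext => [k u v|k u v|? ? ? ? P2 L2 R2 U2]; rewrite ?(lin1, lin2) //.
move: X; apply: tube_linear_ext => [k u v|k u v|? ? ? ? P1 L1 R1 U1]; rewrite ?(lin1, lin2) //.
rewrite !stack_at_quad.
apply: (quad_dinatural ssD irrP (f0 := assoc _ _ _) (f1 := assoc _ _ _)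
  (g0 := associ _ _ _) (g1 := associ _ _ _)).
- exact: stackP_assoc.
- exact: stackL_assoc.
- exact: stackR_assoc.
exact: stackU_assoc.
Qed.

(** The diagram whose arcs are empty and whose lines and legs run straight from the inner to the
    outer circle. Its strands are [unit_obj], which need not be simple, so [quad] resolves them. *)
Definition one_at m n (o : circle I m n) : tube_at irr o o :=
  @quad C D I irr m m n n o o unit_obj unit_obj unit_obj unit_obj
    (luniti _ ∘ runiti _) (runiti _ ∘ lunit _) (luniti _ ∘ runit _) (runit _ ∘ lunit _).

Lemma stack_at_1l m n s t (o : circle I s t) (i : circle I m n) (X : tube_at irr o i) :
  stack_at (one_at o) X = X.
Proof.
move: X; apply: tube_linear_ext => [k u v|//|K0 K1 L0 L1 P L R U].
  exact: (bilPr (@stack_at_bil _ _ _ _ _ _ _ _ _)).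
rewrite stack_at_quad; apply/esym.
apply: (quad_dinatural ssD irrP (f0 := luniti _) (f1 := luniti _)
  (g0 := runiti _) (g1 := runiti _)).
- exact: stackP_1l.
- exact: stackL_1l.
- exact: stackR_1l.
exact: stackU_1l.
Qed.

Lemma stack_at_1r m n s t (o : circle I s t) (i : circle I m n) (X : tube_at irr o i) :
  stack_at X (one_at i) = X.
Proof.
move: X; apply: tube_linear_ext => [k u v|//|K0 K1 L0 L1 P L R U].
  exact: (bilPl (@stack_at_bil _ _ _ _ _ _ _ _ _)).
rewrite stack_at_quad; apply/esym.
apply: (quad_dinatural ssD irrP (f0 := runiti _) (f1 := runiti _)
  (g0 := luniti _) (g1 := luniti _)).
- exact: stackP_1r.
- exact: stackL_1r.
- exact: stackR_1r.
exact: stackU_1r.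
Qed.

End StackTheory.

(** * Stacking on tube spaces *)

Section DirectSumInjection.
Variables (C : fieldType) (J : finType) (V : J -> lmodType C).

Definition dsum_inj j (v : V j) : dsum V :=
  [ffun k => match eqVneq j k with
             | EqNotNeq E => eq_rect j V v k E
             | NeqNotEq _ => 0
             end].

Lemma dsum_injE j (v : V j) : dsum_inj v j = v.
Proof.
rewrite ffunE; case: eqVneq => [E|/eqP//].
by rewrite (eq_irrelevance E erefl).
Qed.

Lemma dsum_inj_neq j k (v : V j) : j != k -> dsum_inj v k = 0.
Proof. by rewrite ffunE; case: eqVneq => // -> /eqP. Qed.

Lemma dsum_inj_linear j : linear (@dsum_inj j).
Proof.
move=> k u v; apply/ffunP => l; rewrite !ffunE; case: eqVneq => [E|_].
  by case: _ / E.
by rewrite scaler0 addr0.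
Qed.

Lemma dsum_eval_linear j : linear (fun X : dsum V => X j).
Proof. by move=> k X Y; rewrite !ffunE. Qed.

End DirectSumInjection.

Section TubeTheory.
Variables (C : numClosedFieldType) (D : moncat C) (I : finType) (irr : I -> D).
Hypothesis ssD : is_semisimple D.
Hypothesis irrP : is_Irr irr.

Local Notation summand m s n t := (fun oi : circle I s t * circle I m n => tube_at irr oi.1 oi.2).

Definition tube_inj m s n t (o : circle I s t) (i : circle I m n) (X : tube_at irr o i) :
    tube irr m s n t :=
  dsum_inj (V := summand m s n t) (j := (o, i)) X.

Lemma tube_ext m s n t (X Y : tube irr m s n t) :
  (forall (o : circle I s t) (i : circle I m n), tube_proj X o i = tube_proj Y o i) -> X = Y.
Proof. by move=> XY; apply/ffunP => -[o i]; exact: XY. Qed.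

Lemma tube_proj_linear m s n t (o : circle I s t) (i : circle I m n) :
  linear (fun X : tube irr m s n t => tube_proj X o i).
Proof.
exact: (@dsum_eval_linear C _ (summand m s n t) (o, i)).
Qed.

Lemma tube_projP m s n t (o : circle I s t) (i : circle I m n) k (X Y : tube irr m s n t) :
  tube_proj (k *: X + Y) o i = k *: tube_proj X o i + tube_proj Y o i.
Proof. exact: tube_proj_linear. Qed.

Lemma tube_proj_inj m s n t (o : circle I s t) (i : circle I m n) (X : tube_at irr o i) :
  tube_proj (tube_inj X) o i = X.
Proof.
exact: (@dsum_injE C _ (summand m s n t) (o, i) X).
Qed.

Lemma tube_proj_inj_neq m s n t (o o' : circle I s t) (i i' : circle I m n) (X : tube_at irr o i) :
  (o, i) != (o', i') -> tube_proj (tube_inj X) o' i' = 0.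
Proof.
exact: (@dsum_inj_neq C _ (summand m s n t) (o, i) (o', i') X).
Qed.

Lemma tube_inj_linear m s n t (o : circle I s t) (i : circle I m n) :
  linear (@tube_inj m s n t o i).
Proof.
exact: (@dsum_inj_linear C _ (summand m s n t) (o, i)).
Qed.

Lemma tube_proj_stack q m s r n t (X : tube irr m s n t) (X' : tube irr q m r n)
    (o : circle I s t) (i : circle I q r) :
  tube_proj (stack irr X X') o i
  = \sum_(j : circle I m n) stack_at (tube_proj X o j) (tube_proj X' j i).
Proof. by rewrite [LHS]ffunE. Qed.

Lemma stack_bil q m s r n t : bilinear_for *:%R *:%R (@stack C D I irr q m s r n t).
Proof.
split=> X k Y Y'; apply: tube_ext => o i; rewrite tube_projP !tube_proj_stack;
  rewrite scaler_sumr -big_split; apply: eq_bigr => j _ /=; rewrite tube_projP.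
  exact: (bilPl (@stack_at_bil _ _ _ _ _ _ _ _ _ _ _ _ _)).
exact: (bilPr (@stack_at_bil _ _ _ _ _ _ _ _ _ _ _ _ _)).
Qed.

Lemma stack_assoc m0 n0 m1 n1 m2 n2 m3 n3 (X : tube irr m1 m0 n1 n0)
    (Y : tube irr m2 m1 n2 n1) (Z : tube irr m3 m2 n3 n2) :
  stack irr (stack irr X Y) Z = stack irr X (stack irr Y Z).
Proof.
apply: tube_ext => o i; rewrite !tube_proj_stack.
under eq_bigr => j _ do rewrite tube_proj_stack
  (bil_suml (@stack_at_bil _ _ _ _ _ _ _ _ _ _ _ _ _)).
under [RHS]eq_bigr => j _ do rewrite tube_proj_stack
  (bil_sumr (@stack_at_bil _ _ _ _ _ _ _ _ _ _ _ _ _)).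
rewrite exchange_big; apply: eq_bigr => j _; apply: eq_bigr => j' _.
exact: stack_at_assoc.
Qed.

Lemma stack_inj q m s r n t (o : circle I s t) (j : circle I m n) (i : circle I q r)
    (X : tube_at irr o j) (Y : tube_at irr j i) :
  stack irr (tube_inj X) (tube_inj Y) = tube_inj (stack_at X Y).
Proof.
have B := @stack_at_bil C D I irr.
apply: tube_ext => o' i'; rewrite tube_proj_stack.
have [E|ne] := eqVneq (o, i) (o', i'); last first.
  rewrite tube_proj_inj_neq // big1 // => j' _; move: ne.
  rewrite xpair_eqE negb_and => /orP[no|ni].
    by rewrite [tube_proj (tube_inj X) _ _]tube_proj_inj_neq ?xpair_eqE ?(negPf no) //
      (bil0l (B _ _ _ _ _ _ _ _ _)).
  by rewrite [tube_proj (tube_inj Y) _ _]tube_proj_inj_neq ?xpair_eqE ?(negPf ni) ?andbF //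
    (bil0r (B _ _ _ _ _ _ _ _ _)).
move: E => [? ?]; subst o' i'.
rewrite (bigD1 j) //= big1 => [|j' jj']; first by rewrite !tube_proj_inj addr0.
by rewrite tube_proj_inj_neq ?(bil0l (B _ _ _ _ _ _ _ _ _)) // xpair_eqE eqxx eq_sym.
Qed.

Definition tube_one m n : tube irr m m n n := \sum_(o : circle I m n) tube_inj (one_at irr o).

Lemma tube_proj_one m n (o : circle I m n) : tube_proj (tube_one m n) o o = one_at irr o.
Proof.
rewrite (linear_sum_of (@tube_proj_linear m m n n o o)) (bigD1 o) //= big1 => [|o' oo'].
  by rewrite tube_proj_inj addr0.
by rewrite tube_proj_inj_neq // xpair_eqE (negPf oo').
Qed.

Lemma tube_proj_one_neq m n (o i : circle I m n) : o != i -> tube_proj (tube_one m n) o i = 0.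
Proof.
move=> ne; rewrite (linear_sum_of (@tube_proj_linear m m n n o i)) big1 // => o' _.
rewrite tube_proj_inj_neq // xpair_eqE.
by apply/negP => /andP[/eqP -> /eqP E]; rewrite E eqxx in ne.
Qed.

Lemma stack_1l m s n t (X : tube irr m s n t) : stack irr (tube_one s t) X = X.
Proof.
have B := @stack_at_bil C D I irr.
apply: tube_ext => o i; rewrite tube_proj_stack (bigD1 o) //= big1 => [|j jo].
  by rewrite tube_proj_one stack_at_1l // addr0.
by rewrite tube_proj_one_neq 1?eq_sym // (bil0l (B _ _ _ _ _ _ _ _ _)).
Qed.

Lemma stack_1r m s n t (X : tube irr m s n t) : stack irr X (tube_one m n) = X.
Proof.
have B := @stack_at_bil C D I irr.
apply: tube_ext => o i; rewrite tube_proj_stack (bigD1 i) //= big1 => [|j jo].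
  by rewrite tube_proj_one stack_at_1r // addr0.
by rewrite tube_proj_one_neq // (bil0r (B _ _ _ _ _ _ _ _ _)).
Qed.

End TubeTheory.

(** * Factorization of units *)

Section Factorization.
Variables (C : numClosedFieldType) (D : moncat C) (I : finType) (irr : I -> D).
Hypothesis ssD : is_semisimple D.
Hypothesis irrP : is_Irr irr.

(** By induction: identify 1 with 1 ⊗ 1, resolve the first factor into simple objects and split m
    legs off the second. *)
Lemma unit_legs m : exists (J : finType) (c : J -> m.-tuple I)
    (f : forall j, hom unit_obj (tens_seq [seq irr k | k <- c j]))
    (g : forall j, hom (tens_seq [seq irr k | k <- c j]) unit_obj),
  \sum_j g j ∘ f j = idm (unit_obj : D).
Proof.
elim: m => [|m [J [c [f [g fg]]]]].
  exists unit, (fun=> [tuple]), (fun=> idm _), (fun=> idm _).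
  by rewrite (bigD1 tt) //= comp1m big1 ?addr0 // => -[].
(* A label together with a basis index, so that the resolution of 1 becomes a sum over a single
   finite type. *)
pose P := {k : I & 'I_(\dim {: hom (irr k) (unit_obj : D)})}.
pose e (kp : P) := (vb (hom (irr (tag kp)) unit_obj))`_(tagged kp).
exists (P * J)%type, (fun x => [tuple of tag x.1 :: c x.2]),
  (fun x => (dual_basis (tagged x.1) ⊗m f x.2) ∘ luniti _),
  (fun x => lunit _ ∘ (e x.1 ⊗m g x.2)).
transitivity (\sum_(x : P) \sum_j lunit unit_obj ∘
   ((e x ∘ dual_basis (tagged x)) ⊗m (g j ∘ f j)) ∘ luniti unit_obj).
  rewrite pair_big; apply: eq_bigr => x _ /=.
  by rewrite tensm_comp -!compA.
under eq_bigr => x _ do rewrite -comp_suml -comp_sumr -(bil_sumr (@tensm_bil _ _ _ _ _ _)) fg.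
rewrite -comp_suml -comp_sumr -(bil_suml (@tensm_bil _ _ _ _ _ _)).
have -> : \sum_(x : P) e x ∘ dual_basis (tagged x) = idm unit_obj.
  rewrite -(resolution ssD irrP unit_obj).
  by rewrite (sig_big_dep (fun=> true) (fun _ _ => true)).
by rewrite tensm_id compm1 lunitiK.
Qed.

(** Left legs are tensored in the reverse of their order along the boundary, hence the reversed
    labels and the transports. *)
Lemma unit_llegs m : exists (J : finType) (c : J -> m.-tuple I)
    (f : forall j, hom unit_obj (tens_seq [seq irr k | k <- rev (c j)]))
    (g : forall j, hom (tens_seq [seq irr k | k <- rev (c j)]) unit_obj),
  \sum_j g j ∘ f j = idm (unit_obj : D).
Proof.
have [J [c [f [g fg]]]] := unit_legs m.
have cE j : c j = rev (rev_tuple (c j)) :> seq I by rewrite /= revK.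
exists J, (fun j => rev_tuple (c j)),
  (fun j => eq_rect _ (fun s : seq I => hom unit_obj (tens_seq [seq irr k | k <- s]))
     (f j) _ (cE j)),
  (fun j => eq_rect _ (fun s : seq I => hom (tens_seq [seq irr k | k <- s]) unit_obj)
     (g j) _ (cE j)).
by rewrite -fg; apply: eq_bigr => j _; case: _ / (cE j).
Qed.

Definition factors_through m n s t (X : tube irr s s t t) :=
  exists r : seq (tube irr m s n t * tube irr s m t n),
    X = \sum_(p <- r) stack irr p.1 p.2.

Lemma factors_through_sum m n s t (J : finType) (F : J -> tube irr s s t t) :
  (forall j, factors_through m n (F j)) -> factors_through m n (\sum_j F j).
Proof.
move=> FP; apply: big_ind => [|X Y [r ->] [r' ->]|j _]; last exact: FP.
  by exists [::]; rewrite big_nil.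
by exists (r ++ r'); rewrite big_cat.
Qed.

(* Bend the legs [A] and [B] of [o] onto the bottom strand, which becomes
   [A' ⊗ (x ⊗ B')] and is cut into simple objects; the [m] and [n] new legs are
   cut out of the unit object. The snake identities undo the bending. *)
Lemma one_at_factors m n s t (o : circle I s t) (dualsD : is_rigid D) :
  factors_through m n (tube_inj (one_at irr o)).
Proof.
pose x := bot irr o; pose A := llegs irr o; pose B := rlegs irr o.
(* The bent bottom line reads A, A', x, B', B from left to right, so A' is a dual of A on one side
   and B' a dual of B on the other. *)
have [A' [ev [coev [snakeA _]]]] := (dualsD A).1.
have [B' [ev' [coev' [_ snakeB]]]] := (dualsD B).2.
have [J1 [c1 [f1 [g1 fg1]]]] := unit_llegs m.
have [J2 [c2 [f2 [g2 fg2]]]] := unit_legs n.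
pose w := A' ⊗ (x ⊗ B').
pose bnd : hom x (A ⊗ (w ⊗ B)) := bend x coev coev'.
pose oU := runit (top irr o) ∘ lunit (top irr o ⊗ unit_obj).
have e : one_at irr o = \sum_k \sum_(p < \dim {: hom (irr k) w}) \sum_j1 \sum_j2
  @quad C D I irr s s t t o o (A ⊗ A') (unit_obj ⊗ unit_obj) (B' ⊗ B) (unit_obj ⊗ unit_obj)
    (stackP bnd ((vb (hom (irr k) w))`_p ∘ dual_basis p))
    (stackL (idm _) (((g1 j1 ∘ f1 j1) ⊗m idm _) ∘ (runiti unit_obj ∘ ev)))
    (stackR (idm _) ((idm _ ⊗m (g2 j2 ∘ f2 j2)) ∘ (luniti unit_obj ∘ ev')))
    (stackU oU oU).
  (* Dinaturality along [coev] and [coev'] on the lower strands and unitors on the upper ones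
     replaces the unit by the bent diagram. Resolutions of [w] and of the two units where the new
     legs will be are inserted afterwards. *)
  transitivity (@quad C D I irr s s t t o o (A ⊗ A') (unit_obj ⊗ unit_obj)
    (B' ⊗ B) (unit_obj ⊗ unit_obj)
    (stackP bnd (idm w)) (stackL (idm _) (runiti unit_obj ∘ ev))
    (stackR (idm _) (luniti unit_obj ∘ ev')) (stackU oU oU)).
    apply: (quad_dinatural ssD irrP (f0 := coev) (f1 := luniti _) (g0 := coev') (g1 := luniti _)).
    - exact: stackP_bend.
    - exact: stackL_bend.
    - exact: stackR_bend.
    exact: stackU_bend.
  have qml := quad_ml (D := D) irr.
  rewrite -(resolution ssD irrP w).
  rewrite (bil_sumr (@stackP_bil _ _ _ _ _ _ _ _ _))
    (ml_sum1 (qml _ _ _ _ _ _ _ _ _ _)).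
  apply: eq_bigr => k _.
  rewrite (bil_sumr (@stackP_bil _ _ _ _ _ _ _ _ _))
    (ml_sum1 (qml _ _ _ _ _ _ _ _ _ _)).
  apply: eq_bigr => p _.
  have eL : runiti unit_obj ∘ ev =
      \sum_j ((g1 j ∘ f1 j) ⊗m idm unit_obj) ∘ (runiti unit_obj ∘ ev).
    by rewrite -comp_suml -(bil_suml (@tensm_bil _ _ _ _ _ _)) fg1 tensm_id comp1m.
  rewrite [in LHS]eL (bil_sumr (@stackL_bil _ _ _ _ _ _ _ _ _)) (ml_sum2 (qml _ _ _ _ _ _ _ _ _ _)).
  apply: eq_bigr => j1 _.
  have eR : luniti unit_obj ∘ ev' =
      \sum_j (idm unit_obj ⊗m (g2 j ∘ f2 j)) ∘ (luniti unit_obj ∘ ev').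
    by rewrite -comp_suml -(bil_sumr (@tensm_bil _ _ _ _ _ _)) fg2 tensm_id comp1m.
  by rewrite [in LHS]eR (bil_sumr (@stackR_bil _ _ _ _ _ _ _ _ _))
    (ml_sum3 (qml _ _ _ _ _ _ _ _ _ _)).
have injl : linear (@tube_inj C D I irr s s t t o o) := @tube_inj_linear _ _ _ _ _ _ _ _ _ _.
rewrite e (linear_sum_of injl); apply: factors_through_sum => k.
rewrite (linear_sum_of injl); apply: factors_through_sum => p.
rewrite (linear_sum_of injl); apply: factors_through_sum => j1.
rewrite (linear_sum_of injl); apply: factors_through_sum => j2.
(* All legs are bent downwards, so the upper line keeps its label. *)
pose i : circle I m n := (o.1.1.1, k, c1 j1, c2 j2).
pose X : tube_at irr o i := @quad C D I irr m s n t o i A unit_obj B unit_obj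
  ((idm A ⊗m (dual_basis p ⊗m idm B)) ∘ bnd) (idm _ ∘ (idm A ⊗m g1 j1))
  (idm _ ∘ (g2 j2 ⊗m idm B)) oU.
(* Each inserted composite is cut in two: X receives the dual basis vector, [g1] and [g2], and Y
   receives the basis vector, [f1] and [f2]. *)
pose Y : tube_at irr i o := @quad C D I irr s m t n i o A' unit_obj B' unit_obj
  (vb (hom (irr k) w))`_p ((f1 j1 ⊗m idm _) ∘ (runiti unit_obj ∘ ev))
  ((idm _ ⊗m f2 j2) ∘ (luniti unit_obj ∘ ev')) oU.
exists [:: (tube_inj X, tube_inj Y)]; rewrite big_seq1 stack_inj /X /Y stack_at_quad //.
congr (tube_inj (quad _ _ _ _)).
- exact/esym/stackP_slide.
- by rewrite [RHS]stackL_slide rw_comp -!compA.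
by rewrite [RHS]stackR_slide lw_comp -!compA.
Qed.

Lemma tube_one_factors m n s t (dualsD : is_rigid D) : factors_through m n (tube_one irr s t).
Proof. by apply: factors_through_sum => o; exact: one_at_factors. Qed.

End Factorization.

(** * Morita contexts *)

Section TensorOverTheory.
Variables (C : fieldType) (A M N : lmodType C).
Variables (ract : M -> A -> M) (lact : A -> N -> N).
Local Notation MN := (tens_over ract lact).
Local Notation pi := (tens_pi ract lact).
Local Notation pure := (tens_pure ract lact).

Lemma tens_piE s : pi s = \sum_(p <- s) pure p.1 p.2.
Proof.
elim: s => [|p s IH]; first by rewrite big_nil.
by rewrite tens_pi_cons big_cons IH.
Qed.

Lemma tens_pureZ k x y : k *: pure x y = pure (k *: x) y.
Proof. exact: tens_scaleE. Qed.

Lemma tens_pi_cat s t : pi (s ++ t) = pi s + pi t.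
Proof. by rewrite -tens_addE. Qed.

Lemma tens_pure_bil : bilinear_for *:%R *:%R pure.
Proof.
split=> [y k x x'|x k y y'] /=; rewrite tens_pureZ -tens_pi_cat; apply/tens_piP.
  exact: TRaddl.
apply: TRtrans (TRaddr _ _ _ _ _) _; apply: (@TRcat _ _ _ _ _ _ [:: _] [:: _]).
  exact/TRsym/TRbalC.
exact: TRrefl.
Qed.

Lemma tens_pure_bal x a y : pure (ract x a) y = pure x (lact a y).
Proof. by apply/tens_piP; exact: TRbalA. Qed.

Lemma tens_over_ext (Z : lmodType C) (f g : MN -> Z) : linear f -> linear g ->
  (forall x y, f (pure x y) = g (pure x y)) -> f =1 g.
Proof.
move=> fl gl fg; elim/tens_ind => s.
rewrite tens_piE (linear_sum_of fl) (linear_sum_of gl).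
by apply: eq_bigr => p _.
Qed.

Section Map.
Variables (Z : lmodType C) (beta : M -> N -> Z).

Definition tens_map (z : MN) : Z := \sum_(p <- repr z) beta p.1 p.2.

Hypothesis beta_bil : bilinear_for *:%R *:%R beta.
Hypothesis beta_bal : forall x a y, beta (ract x a) y = beta x (lact a y).

Lemma sum_fscale k s : \sum_(p <- fscale k s) beta p.1 p.2 = k *: \sum_(p <- s) beta p.1 p.2.
Proof.
rewrite /fscale big_map scaler_sumr; apply: eq_bigr => p _ /=.
exact: (bilZl beta_bil).
Qed.

Lemma tens_map_pi s : tens_map (pi s) = \sum_(p <- s) beta p.1 p.2.
Proof.
suff H u v : tens_rel ract lact u v ->
    \sum_(p <- u) beta p.1 p.2 = \sum_(p <- v) beta p.1 p.2.
  exact: H (tens_repr _ _ _).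
elim=> {u v} //.
- by move=> u v w _ -> _ ->.
- by move=> u u' v v' _ e _ e'; rewrite !big_cat /= e e'.
- by move=> u v; rewrite !big_cat /= addrC.
- by move=> k u v _ e; rewrite !sum_fscale e.
- by move=> y; rewrite big_nil big_seq1 (bil0l beta_bil).
- by move=> x x' y; rewrite !big_cons big_nil !addr0 (bilDl beta_bil).
- by move=> x y y'; rewrite !big_cons big_nil !addr0 (bilDr beta_bil).
- by move=> k x y; rewrite !big_seq1 (bilZl beta_bil) (bilZr beta_bil).
by move=> x a y; rewrite !big_seq1 /= beta_bal.
Qed.

Lemma tens_map_pure x y : tens_map (pure x y) = beta x y.
Proof. by rewrite tens_map_pi big_seq1. Qed.

Lemma tens_map_linear : linear tens_map.
Proof.
move=> k; elim/tens_ind => s; elim/tens_ind => t.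
have -> : k *: pi s = pi (fscale k s) by exact: tens_scaleE.
have -> : pi (fscale k s) + pi t = pi (fscale k s ++ t) by exact: tens_addE.
by rewrite !tens_map_pi big_cat sum_fscale.
Qed.

End Map.

Lemma tens_map_fun_linear (Z : lmodType C) (f g h : M -> N -> Z) k z :
  (forall x y, h x y = k *: f x y + g x y) ->
  tens_map h z = k *: tens_map f z + tens_map g z.
Proof.
by move=> hE; rewrite /tens_map scaler_sumr -big_split; apply: eq_bigr => p _ /=.
Qed.

Lemma tens_lactE (B : Type) (lactM : B -> M -> M) b z :
  tens_lact lactM b z = tens_map (fun x y => pure (lactM b x) y) z.
Proof. by rewrite /tens_lact tens_piE big_map. Qed.

Lemma tens_ractE (B : Type) (ractN : N -> B -> N) z b :
  tens_ract ractN z b = tens_map (fun x y => pure x (ractN y b)) z.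
Proof. by rewrite /tens_ract tens_piE big_map. Qed.

End TensorOverTheory.

Definition linear_of (C : fieldType) (U V : lmodType C) (f : U -> V) (fl : linear f) :
    {linear U -> V} :=
  HB.pack f (GRing.isLinear.Build C U V _ f fl).

Section InducedAction.
Variables (C : fieldType).
Variables (A : lmodType C) (mulA : A -> A -> A) (oneA : A).
Variables (B : lmodType C) (mulB : B -> B -> B) (oneB : B).
Variables (M : lmodType C) (lM : B -> M -> M) (rM : M -> A -> M).
Hypothesis bimM : is_bimodule mulB oneB mulA oneA lM rM.
Variables (N : lmodType C) (lN : A -> N -> N).
Local Notation pure := (tens_pure rM lN).

Let lM_bil := lmodule_bilinear (bimodule_l bimM).

Lemma lact_tens_bil b : bilinear_for *:%R *:%R (fun x y => pure (lM b x) y).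
Proof.
split=> w k x y /=; last exact: (bilPr (@tens_pure_bil _ _ _ _ _ _)).
by rewrite (bilPr lM_bil) (bilPl (@tens_pure_bil _ _ _ _ _ _)).
Qed.

Lemma lact_tens_bal b x a y : pure (lM b (rM x a)) y = pure (lM b x) (lN a y).
Proof. by rewrite -(bimodule_assoc bimM) tens_pure_bal. Qed.

Lemma tens_lact_pure b x y : tens_lact lM b (pure x y) = pure (lM b x) y.
Proof. by rewrite tens_lactE (tens_map_pure (lact_tens_bil b) (lact_tens_bal b)). Qed.

Lemma tens_lact_linear b : linear (@tens_lact C A M N rM lN B lM b).
Proof.
move=> k u v; rewrite !tens_lactE.
exact: (tens_map_linear (lact_tens_bil b) (lact_tens_bal b)).
Qed.

Lemma tens_lact_is_lmodule : is_lmodule mulB oneB (@tens_lact C A M N rM lN B lM).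
Proof.
split.
- split=> [z k b b'|b]; last exact: tens_lact_linear.
  rewrite /= !tens_lactE; apply: tens_map_fun_linear => x y.
  by rewrite (bilPl lM_bil) (bilPl (@tens_pure_bil _ _ _ _ _ _)).
- move=> b b'; apply: tens_over_ext => [k u v|k u v|x y]; rewrite ?tens_lact_linear //.
  by rewrite !tens_lact_pure (lmodule_assoc (bimodule_l bimM)).
apply: tens_over_ext => [k u v|//|x y]; first exact: tens_lact_linear.
by rewrite tens_lact_pure (lmodule_1 (bimodule_l bimM)).
Qed.

End InducedAction.

Section MoritaContextDef.
Variables (C : fieldType).
Variables (A : lmodType C) (mulA : A -> A -> A) (oneA : A).
Variables (B : lmodType C) (mulB : B -> B -> B) (oneB : B).
Variables (M : lmodType C) (lM : B -> M -> M) (rM : M -> A -> M).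
Variables (N : lmodType C) (lN : A -> N -> N) (rN : N -> B -> N).
Variables (mn : M -> N -> B) (nm : N -> M -> A).

(** [mc_lM] and [mc_lN] are the mixed associativity laws. The images of the pairings are two-sided
    ideals, so [mc_oneA] and [mc_oneB] express surjectivity. *)
Record morita_context : Prop := MoritaContext {
  mc_M : is_bimodule mulB oneB mulA oneA lM rM;
  mc_N : is_bimodule mulA oneA mulB oneB lN rN;
  mc_mn_bil : bilinear_for *:%R *:%R mn;
  mc_nm_bil : bilinear_for *:%R *:%R nm;
  mc_mn_bal : forall x a y, mn (rM x a) y = mn x (lN a y);
  mc_nm_bal : forall y b x, nm (rN y b) x = nm y (lM b x);
  mc_mnl : forall b x y, mn (lM b x) y = mulB b (mn x y);
  mc_mnr : forall x y b, mn x (rN y b) = mulB (mn x y) b;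
  mc_nml : forall a y x, nm (lN a y) x = mulA a (nm y x);
  mc_nmr : forall y x a, nm y (rM x a) = mulA (nm y x) a;
  mc_lM : forall x y x', lM (mn x y) x' = rM x (nm y x');
  mc_lN : forall y x y', lN (nm y x) y' = rN y (mn x y');
  mc_oneA : exists r : seq (N * M), oneA = \sum_(p <- r) nm p.1 p.2;
  mc_oneB : exists r : seq (M * N), oneB = \sum_(p <- r) mn p.1 p.2
}.

End MoritaContextDef.

Section MoritaContextTheory.
Variables (C : fieldType).
Variables (A : lmodType C) (mulA : A -> A -> A) (oneA : A).
Variables (B : lmodType C) (mulB : B -> B -> B) (oneB : B).
Variables (M : lmodType C) (lM : B -> M -> M) (rM : M -> A -> M).
Variables (N : lmodType C) (lN : A -> N -> N) (rN : N -> B -> N).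
Variables (mn : M -> N -> B) (nm : N -> M -> A).
Hypothesis algB : is_algebra mulB oneB.
Hypothesis mc : morita_context mulA oneA mulB oneB lM rM lN rN mn nm.

Let lM_bil := lmodule_bilinear (bimodule_l (mc_M mc)).
Let rN_bil := rmodule_bilinear (bimodule_r (mc_N mc)).
Let mulB_bil := alg_bilinear algB.
Local Notation MN := (tens_over rM lN).
Local Notation pure := (tens_pure rM lN).

Lemma ract_tens_bil b : bilinear_for *:%R *:%R (fun x y => pure x (rN y b)).
Proof.
split=> w k x y /=; first exact: (bilPl (@tens_pure_bil _ _ _ _ _ _)).
by rewrite (bilPl rN_bil) (bilPr (@tens_pure_bil _ _ _ _ _ _)).
Qed.

Lemma ract_tens_bal b x a y : pure (rM x a) (rN y b) = pure x (rN (lN a y) b).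
Proof. by rewrite (bimodule_assoc (mc_N mc)) tens_pure_bal. Qed.

(** With the unit of B written as the sum of the [mn p.1 p.2], the inverse sends [b] to the sum of
    the [pure (lM b p.1) p.2]. *)
Lemma morita_context_iso :
  bimodule_iso (M := MN) (N := B) (tens_lact lM) (tens_ract rN) mulB mulB.
Proof.
pose phi : MN -> B := tens_map mn.
have phil : linear phi := tens_map_linear (mc_mn_bil mc) (mc_mn_bal mc).
have phiE x y : phi (pure x y) = mn x y := tens_map_pure (mc_mn_bil mc) (mc_mn_bal mc) x y.
have [r rE] := mc_oneB mc.
exists (linear_of phil); split.
- pose psi b : MN := \sum_(p <- r) pure (lM b p.1) p.2.
  have psil : linear psi.
    apply: linear_big => p k b b'.
    by rewrite (bilPl lM_bil) (bilPl (@tens_pure_bil _ _ _ _ _ _)).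
  exists psi => [z|b] /=; last first.
    rewrite (linear_sum_of phil) -[RHS](alg_1r algB) rE (bil_sumr mulB_bil).
    by apply: eq_bigr => p _; rewrite phiE (mc_mnl mc).
  move: z; apply: tens_over_ext => [k u v|//|x y]; first by rewrite phil psil.
  rewrite phiE -[X in _ = pure _ X](rmodule_1 (bimodule_r (mc_N mc))) rE (bil_sumr rN_bil).
  rewrite (bil_sumr (@tens_pure_bil _ _ _ _ _ _)); apply: eq_bigr => p _.
  by rewrite (mc_lM mc) tens_pure_bal (mc_lN mc).
- move=> b; apply: tens_over_ext => [k u v|k u v|x y] /=.
  + by rewrite (tens_lact_linear (mc_M mc)) phil.
  + by rewrite phil (bilPr mulB_bil).
  by rewrite (tens_lact_pure (mc_M mc)) !phiE (mc_mnl mc).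
move=> z b /=; rewrite tens_ractE; move: z.
have L := tens_map_linear (ract_tens_bil b) (@ract_tens_bal b).
apply: tens_over_ext => [k u v|k u v|x y]; first by rewrite L phil.
  by rewrite phil (bilPl mulB_bil).
by rewrite (tens_map_pure (ract_tens_bil b) (@ract_tens_bal b)) !phiE (mc_mnr mc).
Qed.

End MoritaContextTheory.

(** * Functors between module categories induced by bimodules *)

Section InducedFunctor.
Variables (C : fieldType).
Variables (A : lmodType C) (mulA : A -> A -> A) (oneA : A).
Variables (B : lmodType C) (mulB : B -> B -> B) (oneB : B).
Variables (M : lmodType C) (lM : B -> M -> M) (rM : M -> A -> M).
Hypothesis bimM : is_bimodule mulB oneB mulA oneA lM rM.

Definition induced_module (X : lmodule mulA oneA) : lmodule mulB oneB :=
  LModule (tens_lact_is_lmodule bimM (@lmodule_act _ _ _ _ X)).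

Section Map.
Variables (X Y : lmodule mulA oneA) (f : lmodule_hom X Y).

Let beta m (x : X) : induced_module Y := tens_pure rM (@lmodule_act _ _ _ _ Y) m (f x).

Lemma induced_bil : bilinear_for *:%R *:%R beta.
Proof.
split=> w k x y; rewrite /beta.
  exact: (bilPl (@tens_pure_bil _ _ _ _ _ _)).
by rewrite linearP (bilPr (@tens_pure_bil _ _ _ _ _ _)).
Qed.

Lemma induced_bal m a x : beta (rM m a) x = beta m (lmodule_act a x).
Proof. by rewrite /beta tens_pure_bal lmodule_funP. Qed.

Definition induced_fun : induced_module X -> induced_module Y := tens_map beta.

Lemma induced_fun_linear : linear induced_fun.
Proof. exact: tens_map_linear induced_bil induced_bal. Qed.

Lemma induced_fun_pure m x : induced_fun (tens_pure rM (@lmodule_act _ _ _ _ X) m x)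
  = tens_pure rM (@lmodule_act _ _ _ _ Y) m (f x).
Proof. exact: tens_map_pure induced_bil induced_bal m x. Qed.

Lemma induced_funP b z :
  linear_of induced_fun_linear (lmodule_act b z) = lmodule_act b (linear_of induced_fun_linear z).
Proof.
move: z; apply: tens_over_ext => [k u v|k u v|m x] /=.
- by rewrite (tens_lact_linear bimM) induced_fun_linear.
- by rewrite induced_fun_linear (tens_lact_linear bimM).
by rewrite (tens_lact_pure bimM) !induced_fun_pure (tens_lact_pure bimM).
Qed.

Definition induced_hom : lmodule_hom (induced_module X) (induced_module Y) :=
  LModuleHom induced_funP.

End Map.

Lemma induced_linear X Y (k : C) (f g h : lmodule_hom X Y) :
  (forall x, h x = k *: f x + g x) ->
  forall z, induced_hom h z = k *: induced_hom f z + induced_hom g z.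
Proof.
move=> hE z; apply: tens_map_fun_linear => m x.
by rewrite hE (bilPr (@tens_pure_bil _ _ _ _ _ _)).
Qed.

Lemma induced_id X : induced_hom (lmodule_id X) =1 id.
Proof.
apply: tens_over_ext => [||m x]; first exact: induced_fun_linear.
  by move=> k u v.
exact: induced_fun_pure.
Qed.

Lemma induced_comp X Y Z (g : lmodule_hom Y Z) (f : lmodule_hom X Y) :
  induced_hom (lmodule_comp g f) =1 induced_hom g \o induced_hom f.
Proof.
apply: tens_over_ext => [|k u v|m x] /=; first exact: induced_fun_linear.
  by rewrite !induced_fun_linear.
by rewrite !induced_fun_pure.
Qed.

Definition induced_functor : lmodule_functor mulA oneA mulB oneB :=
  LModuleFunctor induced_linear induced_id induced_comp.

End InducedFunctor.

(** * The counit isomorphisms of a Morita context *)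

Section MoritaCounit.
Variables (C : fieldType).
Variables (A : lmodType C) (mulA : A -> A -> A) (oneA : A).
Variables (B : lmodType C) (mulB : B -> B -> B) (oneB : B).
Variables (M : lmodType C) (lM : B -> M -> M) (rM : M -> A -> M).
Variables (N : lmodType C) (lN : A -> N -> N) (rN : N -> B -> N).
Variables (mn : M -> N -> B) (nm : N -> M -> A).
Hypothesis mc : morita_context mulA oneA mulB oneB lM rM lN rN mn nm.

(** The bimodule proofs are separate variables, so that after exchanging M and N both counits speak
    of the very same two functors. *)
Hypothesis bimM : is_bimodule mulB oneB mulA oneA lM rM.
Hypothesis bimN : is_bimodule mulA oneA mulB oneB lN rN.

Local Notation F := (induced_module bimM).
Local Notation G := (induced_module bimN).

Section Component.
Variable X : lmodule mulA oneA.
Local Notation act := (@lmodule_act _ _ _ _ X).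

Let act_bil : bilinear_for *:%R *:%R act := lmodule_bilinear (lmoduleP X).
Let actA a b x : act a (act b x) = act (mulA a b) x := lmodule_assoc (lmoduleP X) a b x.

Let beta n m (x : X) := act (nm n m) x.

Let beta_bil n : bilinear_for *:%R *:%R (beta n).
Proof.
split=> w k x y; rewrite /beta; last exact: (bilPr act_bil).
by rewrite (bilPr (mc_nm_bil mc)) (bilPl act_bil).
Qed.

Let beta_bal n m a x : beta n (rM m a) x = beta n m (act a x).
Proof. by rewrite /beta (mc_nmr mc) actA. Qed.

(** The counit sends n ⊗ (m ⊗ x) to ⟨n, m⟩x. It is defined in two stages, first on [F X] for fixed
    n. *)
Let gamma n (z : F X) : X := tens_map (beta n) z.

Let gamma_pure n m x : gamma n (tens_pure rM act m x) = act (nm n m) x.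
Proof. exact: (tens_map_pure (beta_bil n) (beta_bal n)). Qed.

Let gamma_linear n : linear (gamma n).
Proof. exact: tens_map_linear (beta_bil n) (beta_bal n). Qed.

Let gamma_bil : bilinear_for *:%R *:%R gamma.
Proof.
split=> [z k n n'|n]; last exact: gamma_linear.
apply: tens_map_fun_linear => m x.
by rewrite /beta (bilPl (mc_nm_bil mc)) (bilPl act_bil).
Qed.

Let gamma_bal n b z : gamma (rN n b) z = gamma n (lmodule_act b z).
Proof.
move: z; apply: tens_over_ext => [|k u v|m x]; first exact: gamma_linear.
  by rewrite /= (tens_lact_linear bimM) gamma_linear.
by rewrite /= (tens_lact_pure bimM) !gamma_pure (mc_nm_bal mc).
Qed.

Definition counit_fun : G (F X) -> X := tens_map gamma.

Lemma counit_linear : linear counit_fun.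
Proof. exact: tens_map_linear gamma_bil gamma_bal. Qed.

Lemma counit_pure n m x :
  counit_fun (tens_pure rN (@lmodule_act _ _ _ _ (F X)) n (tens_pure rM act m x))
  = act (nm n m) x.
Proof. by rewrite /counit_fun (tens_map_pure gamma_bil gamma_bal) gamma_pure. Qed.

Lemma double_tens_ext (Z : lmodType C) (f g : G (F X) -> Z) : linear f -> linear g ->
  (forall n m x, f (tens_pure rN (@lmodule_act _ _ _ _ (F X)) n (tens_pure rM act m x))
               = g (tens_pure rN (@lmodule_act _ _ _ _ (F X)) n (tens_pure rM act m x))) ->
  f =1 g.
Proof.
move=> fl gl fg; apply: tens_over_ext => // n.
apply: tens_over_ext => [k u v|k u v|m x]; last exact: fg.
  by rewrite (bilPr (@tens_pure_bil _ _ _ _ _ _)) fl.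
by rewrite (bilPr (@tens_pure_bil _ _ _ _ _ _)) gl.
Qed.

Lemma counit_act a w :
  linear_of counit_linear (lmodule_act a w) = lmodule_act a (linear_of counit_linear w).
Proof.
move: w; apply: double_tens_ext => [k u v|k u v|n m x] /=.
- by rewrite (tens_lact_linear bimN) counit_linear.
- by rewrite counit_linear (bilPr act_bil).
by rewrite (tens_lact_pure bimN) !counit_pure (mc_nml mc) actA.
Qed.

Definition counit : lmodule_hom (G (F X)) X := LModuleHom counit_act.

(** With the unit of A written as the sum of the [nm p.1 p.2], the inverse sends x to the sum of the
    p.1 ⊗ (p.2 ⊗ x). *)
Lemma counit_bij : bijective counit.
Proof.
have [r rE] := mc_oneA mc.
pose inv (x : X) : G (F X) :=
  \sum_(p <- r) tens_pure rN (@lmodule_act _ _ _ _ (F X)) p.1 (tens_pure rM act p.2 x).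
have invl : linear inv.
  apply: linear_big => p k x y.
  by rewrite !(bilPr (@tens_pure_bil _ _ _ _ _ _)).
have sumX x : \sum_(p <- r) act (nm p.1 p.2) x = x.
  by rewrite -(bil_suml act_bil) -rE (lmodule_1 (lmoduleP X)).
have sumN n : \sum_(p <- r) lN (nm p.1 p.2) n = n.
  rewrite -(bil_suml (lmodule_bilinear (bimodule_l bimN))) -rE.
  exact: lmodule_1 (bimodule_l bimN) n.
exists inv => [w|x] /=; last first.
  rewrite (linear_sum_of counit_linear) -[RHS]sumX.
  by apply: eq_bigr => p _; rewrite counit_pure.
move: w; apply: double_tens_ext => [k u v|//|n m x]; first by rewrite counit_linear invl.
(* Expanding n, both sides become the sum of the p.1 ⊗ (⟨p.2, n⟩m ⊗ x), by mixed associativity and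
   balancing. *)
rewrite counit_pure -[in RHS](sumN n) 
  (bil_suml (@tens_pure_bil _ _ _ _ _ _)); apply: eq_bigr => p _.
rewrite -tens_pure_bal -(mc_lM mc) (mc_lN mc) tens_pure_bal.
by rewrite /= (tens_lact_pure bimM).
Qed.

End Component.

Lemma counit_natural X Y (f : lmodule_hom X Y) :
  counit Y \o fmap (induced_functor bimN) (fmap (induced_functor bimM) f) =1 f \o counit X.
Proof.
apply: double_tens_ext => [k u v|k u v|n m x] /=.
- by rewrite induced_fun_linear counit_linear.
- by rewrite counit_linear linearP.
by rewrite induced_fun_pure /= induced_fun_pure !counit_pure lmodule_funP.
Qed.

End MoritaCounit.

Lemma morita_context_sym (C : fieldType) (A : lmodType C) (mulA : A -> A -> A) (oneA : A)
    (B : lmodType C) (mulB : B -> B -> B) (oneB : B)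
    (M : lmodType C) (lM : B -> M -> M) (rM : M -> A -> M)
    (N : lmodType C) (lN : A -> N -> N) (rN : N -> B -> N)
    (mn : M -> N -> B) (nm : N -> M -> A) :
  morita_context mulA oneA mulB oneB lM rM lN rN mn nm ->
  morita_context mulB oneB mulA oneA lN rN lM rM nm mn.
Proof. by case=> *; split. Qed.

Lemma morita_context_equivalent (C : fieldType) (A : lmodType C) (mulA : A -> A -> A) (oneA : A)
    (B : lmodType C) (mulB : B -> B -> B) (oneB : B)
    (M : lmodType C) (lM : B -> M -> M) (rM : M -> A -> M)
    (N : lmodType C) (lN : A -> N -> N) (rN : N -> B -> N)
    (mn : M -> N -> B) (nm : N -> M -> A) :
  morita_context mulA oneA mulB oneB lM rM lN rN mn nm ->
  morita_equivalent mulA oneA mulB oneB.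
Proof.
move=> mc; have mc' := morita_context_sym mc; have [bimM bimN] := (mc_M mc, mc_N mc).
exists (induced_functor bimM), (induced_functor bimN).
exists (counit mc bimM bimN), (counit mc' bimN bimM).
split.
- exact: counit_bij.
- exact: counit_natural.
- exact: counit_bij.
exact: counit_natural.
Qed.

(** * The Morita context formed by the tube spaces *)

Section TubeMorita.
Variables (C : numClosedFieldType) (D : moncat C) (I : finType) (irr : I -> D).
Hypothesis ssD : is_semisimple D.
Hypothesis rigidD : is_rigid D.
Hypothesis irrP : is_Irr irr.

Lemma tube_algebra m n : is_algebra (tube_mul irr m n) (tube_one irr m n).
Proof.
split; first exact: stack_bil.
- by move=> x y z; rewrite [RHS]stack_assoc.
- by move=> x; exact: stack_1l.
by move=> x; exact: stack_1r.
Qed.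

Lemma tube_bimodule m n s t :
  is_bimodule (tube_mul irr s t) (tube_one irr s t) (tube_mul irr m n) (tube_one irr m n)
    (tube_lact irr m s n t) (tube_ract irr m s n t).
Proof.
split.
- split; first exact: stack_bil.
    by move=> a b x; rewrite [RHS]stack_assoc.
  by move=> x; exact: stack_1l.
- split; first exact: stack_bil.
    by move=> x a b; rewrite [LHS]stack_assoc.
  by move=> x; exact: stack_1r.
by move=> b x a; exact: stack_assoc.
Qed.

(** All actions and pairings are stackings, so the compatibility laws are instances of
    [stack_assoc]. Rigidity enters through the two unit conditions. *)
Lemma tube_morita_context m n s t :
  morita_context (tube_mul irr m n) (tube_one irr m n) (tube_mul irr s t) (tube_one irr s t)
    (tube_lact irr m s n t) (tube_ract irr m s n t)
    (tube_lact irr s m t n) (tube_ract irr s m t n)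
    (@stack _ _ _ irr s m s t n t) (@stack _ _ _ irr m s m n t n).
Proof.
have A := stack_assoc ssD irrP.
split; try exact: stack_bil; try (by move=> *; exact: A); try (by move=> *; rewrite [RHS]A).
- exact: tube_bimodule.
- exact: tube_bimodule.
- exact: tube_one_factors.
exact: tube_one_factors.
Qed.

End TubeMorita.

Theorem theorem4 (R : realType) (D : unitary_multifusion R[i])
    (I : finType) (irr : I -> D) (irrP : is_Irr irr) :
  exists one : forall m n : nat, tube irr m m n n,
    (forall m n : nat, is_algebra (tube_mul irr m n) (one m n))
    /\
    (forall m n s t : nat,
       is_bimodule (tube_mul irr s t) (one s t) (tube_mul irr m n) (one m n)
         (tube_lact irr m s n t) (tube_ract irr m s n t))
    /\
    (forall m n s t : nat,
       bimodule_iso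
         (M := tens_over (tube_ract irr m s n t) (tube_lact irr s m t n))
         (N := tube irr s s t t)
         (tens_lact (tube_lact irr m s n t)) (tens_ract (tube_ract irr s m t n))
         (tube_mul irr s t) (tube_mul irr s t)
       /\
       bimodule_iso
         (M := tens_over (tube_ract irr s m t n) (tube_lact irr m s n t))
         (N := tube irr m m n n)
         (tens_lact (tube_lact irr s m t n)) (tens_ract (tube_ract irr m s n t))
         (tube_mul irr m n) (tube_mul irr m n))
    /\
    (forall m n s t : nat,
       morita_equivalent (tube_mul irr m n) (one m n)
                         (tube_mul irr s t) (one s t)).
Proof.
have ssD := umf_semisimple D; have rigidD : is_rigid D by exact: umf_rigid.
have alg m n := tube_algebra ssD irrP m n.
have ctx m n s t := tube_morita_context ssD rigidD irrP m n s t.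
exists (tube_one irr); split; first exact: alg.
split; first by move=> m n s t; exact: tube_bimodule.
split=> m n s t; last exact: morita_context_equivalent (ctx m n s t).
split; first exact: morita_context_iso (alg s t) (ctx m n s t).
exact: morita_context_iso (alg m n) (ctx s t m n).
Qed.
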